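(* Let $n\geqslant 1$, $\alpha\in[0,1)$, and let $G$ be a graph in $\mathcal{G}_{n,i}$ having the minimum $A_\alpha$-index among all graphs in $\mathcal{G}_{n,i}$. Then: (i) if $i=1$, then $G\cong K_n$; (ii) if $i=\lfloor n/2\rfloor$, then $G\cong P_n$ for even $n$ and $G\cong C_n$ for odd $n$; (iii) if $i=\lceil n/2\rceil$, then $G\cong P_n$; (iv) if $i=\lfloor n/2\rfloor+1$ and $n\geqslant 9$, then $G\cong P_n$ for odd $n$ and $G\cong T_{1,1,n-3}$ for even $n$; (v) if $i=n-1$, then $G\cong K_{1,n-1}$.
   Context: All graphs are finite, simple and connected. For a graph $G$ with adjacency matrix $A(G)$ and diagonal degree matrix $D(G)$, and $\alpha\in[0,1]$, let $A_\alpha(G)=\alpha D(G)+(1-\alpha)A(G)$; the $A_\alpha$-index $\lambda_\alpha(G)$ is the largest eigenvalue of $A_\alpha(G)$. The independence number of $G$ is the maximum size of a set of pairwise non-adjacent vertices. $\mathcal{G}_{n,i}$ denotes the set of connected graphs of order $n$ with independence number $i$. $P_n$, $C_n$, $K_n$, $K_{a,b}$ denote the path, cycle, complete graph and complete bipartite graph. For $1\leqslant a\leqslant b\leqslant c$, $T_{a,b,c}$ is the tree with a single vertex $u$ of degree $3$ such that $T_{a,b,c}-u$ is the disjoint union $P_a\cup P_b\cup P_c$; thus $T_{1,1,n-3}$ has $n$ vertices. *)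

(* Defs.v *)
From HB Require Import structures.
From mathcomp Require Import all_boot all_order all_algebra spectral.
From mathcomp Require Import boolp classical_sets reals.
From mathcomp Require complex.

Set Implicit Arguments.
Unset Strict Implicit.
Unset Printing Implicit Defensive.

Import Order.TTheory GRing.Theory Num.Theory.

Local Open Scope ring_scope.

Record sgraph := SGraph {
  vertex :> finType;
  adj : rel vertex;
  adj_sym : symmetric adj;
  adj_irr : irreflexive adj }.

Definition giso (G H : sgraph) : Prop :=
  exists2 f : G -> H, bijective f & forall x y, adj (f x) (f y) = adj x y.

Definition gconnected (G : sgraph) : Prop := forall x y : G, connect (@adj G) x y.

Definition independent (G : sgraph) (S : {set G}) : bool :=
  [forall x in S, forall y in S, ~~ adj x y].

Definition indep_num (G : sgraph) : nat :=
  (\max_(S : {set G} | independent S) #|S|)%N.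

Definition in_Gni (n i : nat) (G : sgraph) : Prop :=
  [/\ #|G| = n, gconnected G & indep_num G = i].

Section Aalpha.
Variables (R : realType) (G : sgraph).

(* Rows and columns are indexed through the enumeration of the vertices;
   the eigenvalues do not depend on it. *)
Definition adj_mx : 'M[R]_#|G| :=
  \matrix_(i, j) (adj (enum_val i : G) (enum_val j))%:R.

Definition deg (x : G) : nat := #|[pred y | adj x y]|.

Definition deg_mx : 'M[R]_#|G| := diag_mx (\row_i (deg (enum_val i))%:R).

Definition Aalpha (alpha : R) : 'M[R]_#|G| :=
  alpha *: deg_mx + (1 - alpha) *: adj_mx.

(* The set of eigenvalues is finite and, for a nonempty graph, nonempty (the
   matrix is real symmetric), so this supremum is a maximum: see
   [Aalpha_index_max] below. *)
Definition Aalpha_index (alpha : R) : R :=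
  sup [set x : R | eigenvalue (Aalpha alpha) x]%classic.

End Aalpha.

Section OfRel.
Variables (V : finType) (r : rel V).

(* The simple graph on V generated by r: orientation and loops are dropped. *)
Definition rel_adj : rel V := [rel x y | (x != y) && (r x y || r y x)].

Lemma rel_adj_sym : symmetric rel_adj.
Proof. by move=> x y; rewrite /rel_adj /= eq_sym orbC. Qed.

Lemma rel_adj_irr : irreflexive rel_adj.
Proof. by move=> x; rewrite /rel_adj /= eqxx. Qed.

Definition graph_of_rel : sgraph := SGraph rel_adj_sym rel_adj_irr.

End OfRel.

Definition path_graph (n : nat) : sgraph :=
  graph_of_rel (fun i j : 'I_n => (i.+1 == j :> nat)%N).

(* The usual cycle for n >= 3; K_1 and K_2 for n = 1, 2. *)
Definition cycle_graph (n : nat) : sgraph :=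
  graph_of_rel (fun i j : 'I_n => (i.+1 %% n == j :> nat)%N).

Definition complete_graph (n : nat) : sgraph :=
  graph_of_rel (fun _ _ : 'I_n => true).

Definition complete_bipartite (a b : nat) : sgraph :=
  graph_of_rel (fun x y : 'I_a + 'I_b =>
    match x, y with inl _, inr _ => true | _, _ => false end).

(* None is the vertex u of degree 3; the three legs are numbered outwards, so
   that u is joined to vertex 0 of each leg. *)
Definition T_graph (a b c : nat) : sgraph :=
  graph_of_rel (fun x y : option ('I_a + 'I_b + 'I_c) =>
    match x, y with
    | None, Some (inl (inl j)) => (j == 0 :> nat)%N
    | None, Some (inl (inr j)) => (j == 0 :> nat)%N
    | None, Some (inr j) => (j == 0 :> nat)%N
    | Some (inl (inl i)), Some (inl (inl j)) => (i.+1 == j :> nat)%N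
    | Some (inl (inr i)), Some (inl (inr j)) => (i.+1 == j :> nat)%N
    | Some (inr i), Some (inr j) => (i.+1 == j :> nat)%N
    | _, _ => false
    end).

Section RealSymmetric.
Import complex.

Lemma real_sym_eigenvalue (R : realType) n (A : 'M[R]_n) :
  (0 < n)%N -> A^T = A -> exists a, eigenvalue A a.
Proof.
move=> n_gt0 symA; pose f := real_complex R.
have [a ea] := eigenvalue_closed (map_mx f A) n_gt0.
suff ra : a = f (complex.Re a).
  by exists (complex.Re a); move: ea; rewrite ra (eigenvalue_map f).
have [v vA v_nz] := eigenvalueP ea.
pose w := map_mx Num.conj v^T.
have fA : map_mx Num.conj (map_mx f A) = map_mx f A.
  apply/matrixP => i j; rewrite !mxE; apply/CrealP.
  by rewrite complex_real.
have wA : map_mx f A *m w = Num.conj a *: w.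
  have := congr1 (fun u : 'rV_n => map_mx Num.conj u^T) vA.
  by rewrite trmx_mul map_mxM map_trmx symA fA linearZ /= map_mxZ.
have ww : (v *m w) 0 0 != 0.
  rewrite mxE; apply: contraNneq v_nz => /eqP.
  rewrite psumr_eq0 => [/allP v0|i _]; last by rewrite !mxE mul_conjC_ge0.
  apply/eqP/rowP => i; rewrite mxE.
  by have := v0 i (mem_index_enum i); rewrite !mxE mul_conjC_eq0 => /eqP.
have : a * (v *m w) 0 0 = Num.conj a * (v *m w) 0 0.
  have := congr1 (mulmx^~ w) vA.
  by rewrite /= -mulmxA wA -scalemxAl -scalemxAr => /matrixP/(_ 0 0); rewrite !mxE.
by move=> /(mulIf ww)/esym/CrealP/RRe_real.
Qed.

End RealSymmetric.

Lemma Aalpha_sym (R : realType) (G : sgraph) (alpha : R) :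
  (Aalpha G alpha)^T = Aalpha G alpha.
Proof.
apply/matrixP => i j; rewrite !mxE (adj_sym (enum_val j)) eq_sym.
by case: eqVneq => // ->.
Qed.

Lemma Aalpha_index_max (R : realType) (G : sgraph) (alpha : R) :
  (0 < #|G|)%N ->
  eigenvalue (Aalpha G alpha) (Aalpha_index G alpha) /\
  (forall x, eigenvalue (Aalpha G alpha) x -> x <= Aalpha_index G alpha).
Proof.
move=> G_gt0; set A := Aalpha G alpha.
have [a ea] : exists a, eigenvalue A a.
  by apply: real_sym_eigenvalue => //; apply: Aalpha_sym.
have pA_nz : char_poly A != 0 by rewrite monic_neq0 ?char_poly_monic.
have max_in n : forall s : seq R, size s = n -> s != [::] ->
    exists2 m, m \in s & forall x, x \in s -> x <= m.
  elim: n => [|n IHn] [|b s] //= [sz] _.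
  have [->|s_nz] := eqVneq s [::].
    by exists b => [|x]; rewrite ?mem_head // inE => /eqP ->.
  have [m ms m_ub] := IHn s sz s_nz.
  exists (Num.max b m) => [|x].
    by rewrite /Num.max; case: ifP; rewrite !inE ?eqxx ?ms ?orbT.
  by rewrite inE le_max => /predU1P[->|/m_ub ->]; rewrite ?lexx ?orbT.
have has_max : exists2 m, eigenvalue A m & forall x, eigenvalue A x -> x <= m.
  have [s s_roots] : exists s : seq R, forall x, eigenvalue A x = (x \in s).
    pose P k := `[< exists2 s : seq R, uniq s /\ all (eigenvalue A) s & size s = k >].
    have exP : exists k, P k by exists 0%N; apply/asboolP; exists [::].
    have ubP k : P k -> (k <= size (char_poly A))%N.
      move=> /asboolP[s [us es] <-]; apply: ltnW; apply: max_poly_roots => //.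
      by apply: sub_all es => x; rewrite eigenvalue_root_char.
    case: (ex_maxnP exP ubP) => k /asboolP[s [us es] sk] k_max.
    exists s => x; apply/idP/idP => [ex|/(allP es)//].
    apply: contraT => xs; have := k_max k.+1; rewrite ltnn; apply.
    by apply/asboolP; exists (x :: s); rewrite /= ?xs ?ex ?us ?es ?sk.
  have s_nz : s != [::] by move: ea; rewrite s_roots; case: s {s_roots}.
  have [m ms m_ub] := max_in _ s erefl s_nz.
  by exists m => [|x]; rewrite s_roots //; apply: m_ub.
have [m em m_ub] := has_max.
suff -> : Aalpha_index G alpha = m by [].
apply/eqP; rewrite eq_le; apply/andP; split.
  by apply: ge_sup => //; exists m.
by apply: ub_le_sup => //; exists m.
Qed.

(* Main.v *)
Require Import Defs.
From HB Require Import structures.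
From mathcomp Require Import all_boot all_order all_algebra.
From mathcomp Require Import reals.
From mathcomp Require Import spectral zify ring lra.
From mathcomp Require complex.

(* Everything is compared with two thresholds. The index of P_n is below 2, and
   that of C_n equals 2. The indices of the trees T_{1,1,m} stay below their
   limit L, attained by the infinite tree with eigenvector 2 at the branch
   vertex, t at the two leaves and 2 t^j at distance j on the long leg, where
   1/t - t = alpha / (1 - alpha). Remarkably, damping the marks of the affine
   diagrams D, E6, E7, E8 by t^distance gives vectors y with A y >= L y for every
   alpha. Such a y can be pushed forward along any map that is injective on
   neighbourhoods, so the affine D diagram excludes, in a graph of index < L with
   a vertex of degree >= 3, every nonbacktracking walk between vertices of degree
   >= 3, hence all cycles; the star K_{1,4} and E6 then leave only a path with one
   pendant vertex attached, and E7, E8 leave only T_{1,1,n-3} when n >= 9.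
   A path with a pendant vertex has larger index than P_n: detach the end vertex
   of P_n and attach it elsewhere; the Perron vector is concave along P_n, so the
   Rayleigh quotient does not decrease.
   Finally, when 2 i < n some induced subgraph has minimum degree >= 2, so the
   index is at least 2, with equality only for cycles. *)

Set Implicit Arguments.
Unset Strict Implicit.
Unset Printing Implicit Defensive.

Import Order.TTheory GRing.Theory Num.Theory.

Local Open Scope ring_scope.

(** * Rayleigh's bound for real symmetric matrices *)

Section Rayleigh.
Import complex.

(** The complex spectral theorem diagonalises [A] by a unitary [P]. In the coordinates [w] of [u]
    the form becomes the sum of [D 0 j] times the squared modulus of [w 0 j], and each [D 0 j] is at
    most [mu]. *)
Lemma rayleigh_le (R : realType) n (A : 'M[R]_n) (mu : R) :
  A^T = A -> (forall a, eigenvalue A a -> a <= mu) ->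
  forall u : 'rV_n, (u *m A *m u^T) 0 0 <= mu * (u *m u^T) 0 0.
Proof.
move=> symA muP u; pose f := real_complex R; pose B := map_mx f A.
have conjf m p (M : 'M[R]_(m, p)) : map_mx Num.conj (map_mx f M) = map_mx f M.
  by apply/matrixP => i j; rewrite !mxE; apply/CrealP; rewrite complex_real.
have hermB : B \is hermsymmx.
  apply/is_hermitianmxP; rewrite expr0 scale1r /B map_trmx symA.
  by apply/esym/conjf.
have := hermitian_normalmx hermB => /orthomx_spectralP.
have := hermitian_spectral_diag_real hermB.
have := spectral_unitarymx B.
move: (spectralmx B) (spectral_diag B) => P D unitP realD BE.
have unP : P \in unitmx by apply: unitarymx_unit.
(* Each diagonal entry is real and has row [j] of [P] as eigenvector, so it comes from a real
   eigenvalue of [A]. *)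
have eigD j : exists2 r, D 0 j = f r & r <= mu.
  have /complex_realP[r Dr] : D 0 j \is Num.real by apply: (mxOverP realD).
  exists r => //; apply: muP; rewrite -(eigenvalue_map f) -/B.
  apply/eigenvalueP; exists (row j P); last first.
    apply: contraTneq unP => P0; apply/negP => /mulmxV /matrixP/(_ j j)/eqP.
    suff -> : (P *m invmx P) j j = 0 by rewrite !mxE eqxx eq_sym oner_eq0.
    by rewrite mxE big1 // => k _; have /rowP/(_ k) := P0; rewrite !mxE => ->; rewrite mul0r.
  transitivity (D 0 j *: row j P); last by rewrite Dr.
  rewrite -row_mul BE !mulmxA mulmxV // mul1mx.
  apply/rowP => k; rewrite !mxE (bigD1 j) //= big1 ?addr0 => [|i ij].
    by rewrite !mxE eqxx.
  by rewrite !mxE eq_sym (negPf ij) mul0r.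
pose w := map_mx f u *m map_mx Num.conj P^T.
have wT : map_mx Num.conj w^T = P *m map_mx f u^T.
  rewrite /w trmx_mul map_mxM map_trmx -[in RHS](conjf _ _ u^T); congr (_ *m _).
    by rewrite -map_mx_comp trmxK map_mx_id // => x; rewrite /= conjCK.
  by rewrite map_trmx.
have uAE : f ((u *m A *m u^T) 0 0) = \sum_j D 0 j * (w 0 j * Num.conj (w 0 j)).
  have -> : f ((u *m A *m u^T) 0 0) = (w *m diag_mx D *m map_mx Num.conj w^T) 0 0.
    transitivity ((map_mx f u *m B *m map_mx f u^T) 0 0).
      by rewrite -!map_mxM [RHS]mxE.
    by rewrite BE wT /w -(invmx_unitary unitP) !mulmxA.
  rewrite mxE; apply: eq_bigr => j _; rewrite mul_mx_diag !mxE; ring.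
have uuE : f ((u *m u^T) 0 0) = \sum_j (w 0 j * Num.conj (w 0 j)).
  have -> : f ((u *m u^T) 0 0) = (w *m map_mx Num.conj w^T) 0 0.
    rewrite wT /w -(invmx_unitary unitP) mulmxA mulmxKV //.
    by rewrite -map_mxM [RHS]mxE.
  by rewrite mxE; apply: eq_bigr => j _; rewrite !mxE.
suff: f ((u *m A *m u^T) 0 0) <= f (mu * (u *m u^T) 0 0) by rewrite lecR.
have -> : f (mu * (u *m u^T) 0 0) = f mu * f ((u *m u^T) 0 0) by exact: rmorphM.
rewrite uAE uuE mulr_sumr.
apply: ler_sum => j _; have [r -> rmu] := eigD j.
by apply: ler_wpM2r; [rewrite mul_conjC_ge0 | rewrite lecR].
Qed.

End Rayleigh.

(** * The matrix as an operator on functions of vertices *)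

Section Operator.
Variables (R : realType) (G : sgraph) (alpha : R).
Implicit Types (f g : G -> R) (v w : G).

(** The action of the matrix on functions of vertices, so that graph arguments need not mention the
    enumeration behind the matrix. *)
Definition Aop f v : R :=
  alpha * (deg v)%:R * f v + (1 - alpha) * \sum_(w | adj v w) f w.

Lemma mul_Aalpha f :
  \row_i f (enum_val i) *m Aalpha G alpha = \row_i Aop f (enum_val i).
Proof.
apply/rowP => i; rewrite !mxE.
under eq_bigr do rewrite !mxE mulrDr.
rewrite big_split /=; congr (_ + _).
  rewrite (bigD1 i) //= eqxx mulr1n big1 ?addr0; first by rewrite mulrC.
  by move=> j ji; rewrite (negPf ji) mulr0n !mulr0.
rewrite mulr_sumr [RHS]big_mkcond [RHS](reindex (@enum_val G G)) /=; last first.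
  exact/onW_bij/enum_val_bij.
apply: eq_bigr => j _; rewrite adj_sym.
by case: ifP => _; rewrite ?mulr1 ?mulr0 // mulrC.
Qed.

Lemma row_ker_enum (u : 'rV[R]_#|G|) : exists f, u = \row_i f (enum_val i).
Proof.
exists (fun v => u 0 (enum_rank v)); apply/rowP => i.
by rewrite mxE enum_valK.
Qed.

Lemma eigenvalue_AopP a :
  eigenvalue (Aalpha G alpha) a <->
  exists2 f, exists v, f v != 0 & forall v, Aop f v = a * f v.
Proof.
split=> [/eigenvalueP[u uA u0]|[f [v fv] fA]].
  have [f uE] := row_ker_enum u; exists f.
    have [i ui] : exists i, u 0 i != 0.
      apply/existsP; apply: contraNT u0; rewrite negb_exists => /forallP u0.
      by apply/eqP/rowP => i; rewrite mxE; apply/eqP; rewrite -[_ == _]negbK u0.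
    by exists (enum_val i); move: ui; rewrite uE mxE.
  move=> v; move: uA; rewrite uE mul_Aalpha => /rowP/(_ (enum_rank v)).
  by rewrite !mxE enum_rankK.
apply/eigenvalueP; exists (\row_i f (enum_val i)).
  by rewrite mul_Aalpha; apply/rowP => i; rewrite !mxE fA.
apply: contraNneq fv => /rowP/(_ (enum_rank v)).
by rewrite !mxE enum_rankK => ->.
Qed.

Lemma dot_enum f g :
  ((\row_(i < #|G|) f (enum_val i)) *m (\row_(i < #|G|) g (enum_val i))^T) 0 0 =
  \sum_v f v * g v.
Proof.
rewrite mxE (reindex (@enum_val G G)) /=; last exact/onW_bij/enum_val_bij.
by apply: eq_bigr => i _; rewrite !mxE.
Qed.

Lemma Aop_sym f g : \sum_v f v * Aop g v = \sum_v g v * Aop f v.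
Proof.
under eq_bigr do rewrite mulrDr; under [RHS]eq_bigr do rewrite mulrDr.
rewrite !big_split /=; congr (_ + _); first by apply: eq_bigr => v _; ring.
under eq_bigr => v _ do rewrite mulrCA mulr_sumr.
under [RHS]eq_bigr => v _ do rewrite mulrCA mulr_sumr.
rewrite -!mulr_sumr; congr (_ * _).
rewrite (exchange_big_dep predT) //=; apply: eq_bigr => v _.
by apply: eq_big => [w|w _]; rewrite 1?adj_sym 1?mulrC.
Qed.

Lemma AopD f g v : Aop (fun w => f w + g w) v = Aop f v + Aop g v.
Proof. rewrite /Aop big_split /=; ring. Qed.

Lemma AopZ a f v : Aop (fun w => a * f w) v = a * Aop f v.
Proof. rewrite /Aop -mulr_sumr; ring. Qed.

Local Notation lam := (Aalpha_index G alpha).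

Hypothesis G_gt0 : (0 < #|G|)%N.

Lemma Aop_rayleigh f : \sum_v f v * Aop f v <= lam * \sum_v f v * f v.
Proof.
have [_ le_lam] := Aalpha_index_max alpha G_gt0.
have := rayleigh_le (Aalpha_sym G alpha) le_lam (\row_i f (enum_val i)).
by rewrite mul_Aalpha !dot_enum; under eq_bigr do rewrite mulrC.
Qed.

(* A maximiser of the Rayleigh quotient is an eigenvector: perturb it in the
   direction of its defect. *)
Lemma Aop_rayleigh_eq f :
  lam * \sum_v f v * f v <= \sum_v f v * Aop f v ->
  forall v, Aop f v = lam * f v.
Proof.
move=> ge_f; pose h v := Aop f v - lam * f v.
have fh0 : \sum_v f v * h v = 0.
  have : \sum_v f v * h v = \sum_v f v * Aop f v - lam * \sum_v f v * f v.
    by rewrite mulr_sumr -sumrB; apply: eq_bigr => v _; rewrite /h; ring.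
  by have := Aop_rayleigh f; lra.
pose N := \sum_v h v * h v; pose M := \sum_v h v * Aop h v - lam * N.
have key e : 2 * e * N + e ^+ 2 * M <= 0.
  have := Aop_rayleigh (fun v => f v + e * h v).
  rewrite -subr_le0 mulr_sumr -sumrB; congr (_ <= _).
  transitivity (\sum_v (f v * h v + 2 * e * (h v * h v) +
    e ^+ 2 * (h v * Aop h v - lam * (h v * h v)) +
    e * (f v * Aop h v - h v * Aop f v))).
    apply: eq_bigr => v _; rewrite AopD AopZ /h; ring.
  rewrite !big_split /= fh0 -!mulr_sumr !sumrB -mulr_sumr -/N -/M.
  by rewrite (Aop_sym f h) subrr mulr0 addr0 add0r.
have N0 : N = 0.
  have N_ge0 : 0 <= N by apply: sumr_ge0 => v _; rewrite -expr2 sqr_ge0.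
  apply/eqP; rewrite eq_le N_ge0 andbT leNgt; apply/negP => N_gt0.
  have M1 : 0 < 1 + `|M| by rewrite ltr_pwDl.
  (* For this [e] the left side of [key] is [e ^+ 2] times 2 (1 + |M|) + M, which is positive. *)
  have := key (N / (1 + `|M|)); apply/negP; rewrite -ltNge.
  have -> : 2 * (N / (1 + `|M|)) * N + (N / (1 + `|M|)) ^+ 2 * M =
    (N / (1 + `|M|)) ^+ 2 * (2 * (1 + `|M|) + M).
    by field; rewrite gt_eqF.
  rewrite mulr_gt0 ?exprn_gt0 ?divr_gt0 //.
  have : - M <= `|M| by rewrite -normrN ler_norm.
  by have := normr_ge0 M; lra.
move=> v; apply/eqP; rewrite -subr_eq0 -/(h v) -sqrf_eq0 expr2.
move/eqP: N0; rewrite psumr_eq0 => [/allP/(_ v)|w _]; last by rewrite -expr2 sqr_ge0.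
by rewrite mem_index_enum; apply.
Qed.

End Operator.

Lemma gconnected_ind (G : sgraph) (P : pred G) (x0 : G) :
  gconnected G -> P x0 -> (forall v w, adj v w -> P v -> P w) -> forall v, P v.
Proof.
move=> conG Px0 PadjP v; have /connectP[p] := conG x0 v.
elim: p x0 Px0 => [|w p IHp] x0 Px0 /=; first by move=> _ ->.
by case/andP=> /PadjP/(_ Px0)/IHp.
Qed.

(** * Perron vectors, subsolutions and supersolutions *)

Section Perron.
Variables (R : realType) (G : sgraph) (alpha : R).
Implicit Types (f g : G -> R) (v w : G).
Hypotheses (alpha_ge0 : 0 <= alpha) (alpha_lt1 : alpha < 1).
Hypothesis G_gt0 : (0 < #|G|)%N.
Local Notation lam := (Aalpha_index G alpha).

Let k_ge0 : 0 <= 1 - alpha. Proof. by rewrite subr_ge0 ltW. Qed.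

Lemma rayleigh_lower f (L : R) : (exists v, f v != 0) ->
  L * \sum_v f v * f v <= \sum_v f v * Aop alpha f v -> L <= lam.
Proof.
move=> [v fv] le_f; have := le_trans le_f (Aop_rayleigh alpha G_gt0 f).
rewrite ler_pM2r // (bigD1 v) //= ltr_pwDl //.
  by rewrite -expr2 exprn_even_gt0.
by apply: sumr_ge0 => w _; rewrite -expr2 sqr_ge0.
Qed.

Lemma rayleigh_lower_eq f (L : R) :
  L * \sum_v f v * f v <= \sum_v f v * Aop alpha f v -> lam <= L ->
  forall v, Aop alpha f v = lam * f v.
Proof.
move=> le_f leL; apply: Aop_rayleigh_eq => //; apply: le_trans le_f.
by apply: ler_wpM2r => //; apply: sumr_ge0 => w _; rewrite -expr2 sqr_ge0.
Qed.

(** A zero at [v] makes the sum over its neighbours vanish, since [1 - alpha > 0], so zeros would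
    spread over the whole connected graph. *)
Lemma nneg_eigen_pos f (a : R) : gconnected G ->
  (forall v, 0 <= f v) -> (exists v, f v != 0) ->
  (forall v, Aop alpha f v = a * f v) -> forall v, 0 < f v.
Proof.
move=> conG f_ge0 [v0 fv0] fA v; rewrite lt0r f_ge0 andbT.
move: v; apply: (gconnected_ind conG (x0 := v0)) => // w v wv.
apply: contraNneq => fv; have := fA v; rewrite /Aop fv !mulr0 add0r => /eqP.
rewrite mulf_eq0 subr_eq0 gt_eqF //= psumr_eq0 // => /allP/(_ w).
by rewrite mem_index_enum adj_sym wv; apply.
Qed.

(** Pairing the pointwise inequality with [f] itself bounds the Rayleigh quotient from below. *)
Lemma subsolution_le f (L : R) : (forall v, 0 <= f v) -> (exists v, f v != 0) ->
  (forall v, L * f v <= Aop alpha f v) -> L <= lam.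
Proof.
move=> f_ge0 f_nz fA; apply: rayleigh_lower f_nz _.
by rewrite mulr_sumr; apply: ler_sum => v _; rewrite mulrCA ler_wpM2l.
Qed.

(** If [lam <= L], the subsolution attains the maximal Rayleigh quotient, so it is an
    eigenvector. *)
Lemma subsolution_eq f (L : R) : gconnected G ->
  (forall v, 0 <= f v) -> (exists v, f v != 0) ->
  (forall v, L * f v <= Aop alpha f v) -> lam <= L ->
  (forall v, 0 < f v) /\ (forall v, Aop alpha f v = L * f v).
Proof.
move=> conG f_ge0 f_nz fA leL.
have lamE : lam = L by apply/eqP; rewrite eq_le leL (subsolution_le f_ge0).
have fE v : Aop alpha f v = L * f v.
  rewrite -[in RHS]lamE; apply: rayleigh_lower_eq leL v.
  by rewrite mulr_sumr; apply: ler_sum => v _; rewrite mulrCA ler_wpM2l.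
by split=> //; apply: nneg_eigen_pos fE.
Qed.

(** Taking absolute values of an eigenvector for the index does not lower its Rayleigh quotient, so
    the result is again an eigenvector. *)
Lemma perron : gconnected G ->
  exists2 f, forall v, 0 < f v & forall v, Aop alpha f v = lam * f v.
Proof.
move=> conG; have [/eigenvalue_AopP[f [v fv] fA] _] := Aalpha_index_max alpha G_gt0.
pose g v : R := `|f v|.
have gv : exists v, g v != 0 by exists v; rewrite normr_eq0.
have gA w : Aop alpha g w = lam * g w.
  apply: Aop_rayleigh_eq => //; rewrite mulr_sumr; apply: ler_sum => {}w _.
  have -> : lam * (g w * g w) = f w * Aop alpha f w.
    by rewrite fA [RHS]mulrCA /g -normrM -expr2 ger0_norm ?sqr_ge0.
  apply: (le_trans (ler_norm _)); rewrite normrM.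
  apply: ler_wpM2l; first exact: normr_ge0.
  apply: (le_trans (ler_normD _ _)); apply: lerD.
    by rewrite normrM ger0_norm ?mulr_ge0.
  by rewrite normrM ger0_norm //; apply: ler_wpM2l; rewrite ?ler_norm_sum.
exists g => //; apply: nneg_eigen_pos gA => // w; exact: normr_ge0.
Qed.

(** Pair with the Perron vector [g] and move the operator onto it by symmetry; strictness at one
    vertex survives because [g] is positive. *)
Lemma supersolution_lt f (L : R) : gconnected G -> (forall v, 0 < f v) ->
  (forall v, Aop alpha f v <= L * f v) -> (exists v, Aop alpha f v < L * f v) ->
  lam < L.
Proof.
move=> conG f_gt0 fA [v0 fv0]; have [g g_gt0 gA] := perron conG.
have : \sum_v g v * Aop alpha f v < L * \sum_v g v * f v.
  rewrite mulr_sumr (bigD1 v0) //= [ltRHS](bigD1 v0) //=.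
  apply: ltr_leD; first by rewrite mulrCA ltr_pM2l.
  by apply: ler_sum => v _; rewrite mulrCA ler_pM2l.
rewrite Aop_sym.
have -> : \sum_v f v * Aop alpha g v = lam * \sum_v g v * f v.
  by rewrite mulr_sumr; apply: eq_bigr => v _; rewrite gA mulrCA [f v * _]mulrC.
rewrite ltr_pM2r // (bigD1 v0) //= ltr_pwDl ?mulr_gt0 //.
by apply: sumr_ge0 => v _; rewrite mulr_ge0 ?ltW.
Qed.

Lemma Aop_nbE f v (s : seq G) : uniq s -> (forall w, adj v w = (w \in s)) ->
  Aop alpha f v = alpha * (size s)%:R * f v + (1 - alpha) * \sum_(w <- s) f w.
Proof.
move=> us sE; rewrite /Aop /deg (eq_card (B := mem s)); last first.
  by move=> w; rewrite inE sE.
rewrite (card_uniqP us) big_uniq //=; congr (_ + _ * _).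
by apply: eq_bigl => w; rewrite sE.
Qed.

(** For nonnegative [f], neighbours omitted from [s] only add to the right side; this is how a
    subgraph certifies a bound on the index of [G]. *)
Lemma Aop_nb_ge f v (s : seq G) : (forall v, 0 <= f v) -> uniq s ->
  all (adj v) s ->
  alpha * (size s)%:R * f v + (1 - alpha) * \sum_(w <- s) f w <= Aop alpha f v.
Proof.
move=> f_ge0 us /allP sE; rewrite lerD //.
  rewrite ler_wpM2r // ler_wpM2l // ler_nat -(card_uniqP us).
  by apply/subset_leq_card/fintype.subsetP => w /sE.
rewrite ler_wpM2l // big_uniq //=.
rewrite [leLHS]big_mkcond [leRHS]big_mkcond; apply: ler_sum => w _.
by case: ifP => [/sE ->|_] //; case: ifP.
Qed.

Lemma Aop_nb_le f v (s : seq G) : (forall v, 0 <= f v) ->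
  uniq s ->
  (forall w, adj v w -> w \in s) ->
  Aop alpha f v <= alpha * (size s)%:R * f v + (1 - alpha) * \sum_(w <- s) f w.
Proof.
move=> f_ge0 us sE; rewrite lerD //.
  rewrite ler_wpM2r // ler_wpM2l // ler_nat.
  apply: leq_trans (card_size s).
  by apply/subset_leq_card/fintype.subsetP => w; apply: sE.
rewrite ler_wpM2l //.
rewrite big_uniq //= [leLHS]big_mkcond [leRHS]big_mkcond; apply: ler_sum => w _.
by case: ifP => [/sE ->|_] //; case: ifP.
Qed.

(* The certificate is pushed forward along [phi] by taking maxima over fibres,
   so [phi] only has to be injective on the neighbourhood lists. *)
Lemma subsolution_cover (N : nat) (phi : nat -> G) (y : nat -> R)
    (nb : nat -> seq nat) (L : R) : (0 < N)%N ->
  (forall k, (k < N)%N -> 0 < y k) ->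
  (forall k, (k < N)%N -> [/\ all (gtn N) (nb k), uniq (map phi (nb k)),
     all (adj (phi k)) (map phi (nb k)) &
     L * y k <= alpha * (size (nb k))%:R * y k +
       (1 - alpha) * \sum_(j <- nb k) y j]) ->
  L <= lam.
Proof.
move=> N_gt0 y_gt0 cert.
(* The default 0 covers vertices outside the image; there the inequality only asks for a nonnegative
   right side. *)
pose Y v := \big[Num.max/0]_(k < N | phi k == v) y k.
have YP v : Y v = 0 \/ exists2 k, (k < N)%N & phi k = v /\ Y v = y k.
  rewrite /Y; elim/big_ind: _ => [|x z xP zP|k /eqP kv]; first by left.
    by rewrite /Num.max; case: ifP.
  by right; exists k.
have yY k : (k < N)%N -> y k <= Y (phi k).
  by move=> kN; apply: (le_bigmax_cond _ (fun k : 'I_N => y k) (j := Ordinal kN)).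
have Y_ge0 v : 0 <= Y v by case: (YP v) => [->|[k kN [_ ->]]] //; rewrite ltW ?y_gt0.
apply: (subsolution_le Y_ge0).
  by exists (phi 0%N); rewrite gt_eqF // (lt_le_trans _ (yY _ N_gt0)) ?y_gt0.
move=> v; have [Yv|[k kN [kv Yv]]] := YP v.
  rewrite Yv mulr0 /Aop Yv mulr0 add0r mulr_ge0 //.
  exact: sumr_ge0.
(* Where the maximum is attained at [k], the images of [nb k] are distinct neighbours, each carrying
   at least the value [y j]. *)
have [/allP nbN u_nb adj_nb le_k] := cert k kN.
rewrite -{2}kv; apply: le_trans (Aop_nb_ge Y_ge0 u_nb adj_nb).
rewrite size_map kv Yv; apply: le_trans le_k _.
rewrite lerD2l ler_wpM2l // big_map.
rewrite big_seq [leRHS]big_seq; apply: ler_sum => j /nbN jN; exact: yY.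
Qed.

End Perron.

(** * The decay rate [t], and auxiliary facts on degrees *)

Lemma decay_rate (R : realType) (alpha : R) : 0 <= alpha -> alpha < 1 ->
  exists t, [/\ 0 < t, t <= 1 & alpha * t = (1 - alpha) * (1 - t ^+ 2)].
Proof.
move=> alpha_ge0 alpha_lt1; have k_gt0 : 0 < 1 - alpha by rewrite subr_gt0.
pose b := alpha / (1 - alpha); have b_ge0 : 0 <= b by rewrite divr_ge0 // ltW.
have bE : b * (1 - alpha) = alpha by rewrite divfK // gt_eqF.
pose s := Num.sqrt (b ^+ 2 + 4).
have sE : s ^+ 2 = b ^+ 2 + 4 by rewrite sqr_sqrtr // addr_ge0 ?sqr_ge0.
have s_ge0 : 0 <= s by apply: sqrtr_ge0.
have s_gt : b < s by rewrite -(@ltr_pXn2r _ 2) ?nnegrE // sE ltrDl.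
(* The witness is the positive root of [t ^+ 2 + b * t = 1]. *)
have tE : ((s - b) / 2) ^+ 2 + b * ((s - b) / 2) = 1.
  have -> : ((s - b) / 2) ^+ 2 + b * ((s - b) / 2) = (s ^+ 2 - b ^+ 2) / 4 by field.
  by rewrite sE; field.
have : 0 < (s - b) / 2 by rewrite divr_gt0 // subr_gt0.
move: ((s - b) / 2) tE => t tE t_gt0; exists t; split=> //.
  have : t ^+ 2 <= 1 by rewrite -tE lerDl mulr_ge0 // ltW.
  by rewrite expr_le1 // ltW.
rewrite -[in LHS]bE.
have -> : 1 - t ^+ 2 = b * t by rewrite -tE; ring.
ring.
Qed.

(* [lia] preprocesses every hypothesis, also those on reals and vertices, which
   makes it unusable in most contexts below: keep the arithmetic ones only. *)
Ltac nat_lia :=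
  repeat match goal with
  | H : ?T |- _ => lazymatch T with
    | nat => fail
    | is_true (leq _ _) => fail
    | is_true (negb (leq _ _)) => fail
    | is_true (odd _) => fail
    | is_true (negb (odd _)) => fail
    | is_true (negb (@eq_op _ (_ : nat) _)) => fail
    | @eq nat _ _ => fail
    | _ => clear H
    end
  end; lia.

Lemma size_le_deg (G : sgraph) (v : G) (s : seq G) :
  uniq s -> all (adj v) s -> (size s <= deg v)%N.
Proof.
move=> us /allP sE; rewrite -(card_uniqP us).
by apply/subset_leq_card/fintype.subsetP => w /sE.
Qed.

Lemma deg_ge3_avoid (G : sgraph) (v w : G) : (2 < deg v)%N ->
  exists a b, [/\ adj v a, adj v b, a != w, b != w & a != b].
Proof.
rewrite /deg (cardD1 w) => dv.
have /card_gt1P[a [b []]] : (1 < #|[predD1 [pred y | adj v y] & w]|)%N.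
  by rewrite -(leq_add2l 1); apply: leq_trans dv _; rewrite leq_add2r leq_b1.
by rewrite !inE => /andP[aw va] /andP[bw vb] ab; exists a, b; split.
Qed.

(** * Subgraphs and walks that force the index to be at least [L] *)

Section Certificates.
Variables (R : realType) (G : sgraph) (alpha t L : R).
Hypotheses (alpha_ge0 : 0 <= alpha) (alpha_lt1 : alpha < 1).
(* L = 2 alpha + (1 - alpha) (t + 1/t) is the limit of the indices of T_{1,1,m},
   and t is the decay rate of the limit eigenvector along the infinite leg. *)
Hypotheses (t_gt0 : 0 < t) (t_le1 : t <= 1).
Hypothesis alpha_t : alpha * t = (1 - alpha) * (1 - t ^+ 2).
Hypothesis L_t : L * t = (1 - alpha) * (3 - t ^+ 2).
Hypothesis G_gt0 : (0 < #|G|)%N.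
Local Notation lam := (Aalpha_index G alpha).

Let k_gt0 : 0 < 1 - alpha. Proof. by rewrite subr_gt0. Qed.

(** The form in which [t <= 1] reaches [lra]: the inequalities of the certificates follow from these
    linearly. *)
Let slack n : 0 <= t ^+ n * (1 - t ^+ 2).
Proof. by rewrite mulr_ge0 ?exprn_ge0 ?subr_ge0 ?expr_le1 // ltW. Qed.

(** Multiplying by [t] and cancelling [1 - alpha] removes [alpha] and [L]: a certificate becomes a
    polynomial inequality in [t] alone. *)
Lemma decay_ineqE (n : nat) (y s : R) :
  (L * y <= alpha * n%:R * y + (1 - alpha) * s) =
  ((3 - t ^+ 2) * y <= (1 - t ^+ 2) * n%:R * y + t * s).
Proof.
rewrite -(ler_pM2l t_gt0) -[RHS](ler_pM2l k_gt0); congr (_ <= _).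
  by rewrite mulrA [t * L]mulrC L_t mulrA.
by rewrite !mulrDr !mulrA [t * alpha]mulrC alpha_t; ring.
Qed.

(** The cover lemma with injective [phi]: [l] lists distinct vertices and [nb] the tree edges used,
    while [G] may have further edges between them. *)
Lemma subsolution_tree (u : G) (l : seq G) (y : seq R) (nb : seq (seq nat)) :
  uniq l -> (0 < size l)%N ->
  (forall k, (k < size l)%N -> let s := nth [::] nb k in
    [/\ 0 < y`_k, all (gtn (size l)) s && uniq s,
        all (adj (nth u l k)) (map (nth u l) s) &
        (3 - t ^+ 2) * y`_k <=
        (1 - t ^+ 2) * (size s)%:R * y`_k + t * \sum_(j <- s) y`_j]) ->
  L <= lam.
Proof.
move=> ul l_gt0 cert.
apply: (@subsolution_cover _ _ _ alpha_ge0 alpha_lt1 G_gt0 (size l) (nth u l)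
  (fun k => y`_k) (nth [::] nb)) => // k /cert[] // _ /andP[sl us] adj_s ineq.
split=> //; last by rewrite decay_ineqE.
rewrite map_inj_in_uniq // => i j /(allP sl) il /(allP sl) jl /eqP.
by rewrite nth_uniq // => /eqP.
Qed.

Ltac certify :=
  split; [ by rewrite /= ?mulr_gt0 ?exprn_gt0 | by [] |
    by rewrite /=; do ?[apply/andP; split] |
    rewrite !big_cons big_nil /=;
    have := slack 0; have := slack 1; have := slack 2; have := slack 3;
    have := slack 4; have := slack 5; lra ].

(** Affine D4 with marks 2 and 1, the leaves damped by [t]. *)
Lemma index_ge_star4 (u a b c d : G) : uniq [:: u; a; b; c; d] ->
  all (adj u) [:: a; b; c; d] -> L <= lam.
Proof.
move=> ul /and5P[ua ub uc ud _].
have [au bu cu du] : [/\ adj a u, adj b u, adj c u & adj d u].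
  by rewrite !(adj_sym _ u).
apply: (subsolution_tree (u := u) (l := [:: u; a; b; c; d])
  (y := [:: 2; t; t; t; t])
  (nb := [:: [:: 1; 2; 3; 4]; [:: 0]; [:: 0]; [:: 0]; [:: 0]]%N)) => //.
case=> [_|]. certify.
case=> [_|]. certify.
case=> [_|]. certify.
case=> [_|]. certify.
case=> [_|]. certify.
by [].
Qed.


(* The marks of the affine diagrams E6, E7, E8, damped by t^distance, are
   subsolutions for every alpha because they are affine along each leg. *)
Lemma index_ge_E6 (u a1 a2 b1 b2 c1 c2 : G) : uniq [:: u; a1; a2; b1; b2; c1; c2] ->
  all (adj u) [:: a1; b1; c1] -> adj a1 a2 -> adj b1 b2 -> adj c1 c2 -> L <= lam.
Proof.
move=> ul /and4P[ua ub uc _] a12 b12 c12.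
have [au bu cu] : [/\ adj a1 u, adj b1 u & adj c1 u] by rewrite !(adj_sym _ u).
have [a21 b21 c21] : [/\ adj a2 a1, adj b2 b1 & adj c2 c1].
  by rewrite adj_sym a12 adj_sym b12 adj_sym.
apply: (subsolution_tree (u := u) (l := [:: u; a1; a2; b1; b2; c1; c2])
  (y := [:: 3; 2 * t; t ^+ 2; 2 * t; t ^+ 2; 2 * t; t ^+ 2])
  (nb := [:: [:: 1; 3; 5]; [:: 0; 2]; [:: 1]; [:: 0; 4]; [:: 3]; [:: 0; 6];
             [:: 5]]%N)) => //.
do 7![case=> [_|]; first certify]; by [].
Qed.

Lemma index_ge_E7 (u a b1 b2 b3 c1 c2 c3 : G) : uniq [:: u; a; b1; b2; b3; c1; c2; c3] ->
  all (adj u) [:: a; b1; c1] -> adj b1 b2 -> adj b2 b3 -> adj c1 c2 -> adj c2 c3 ->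
  L <= lam.
Proof.
move=> ul /and4P[ua ub uc _] b12 b23 c12 c23.
have [au bu cu] : [/\ adj a u, adj b1 u & adj c1 u] by rewrite !(adj_sym _ u).
have [b21 b32] : adj b2 b1 /\ adj b3 b2 by rewrite adj_sym b12 adj_sym.
have [c21 c32] : adj c2 c1 /\ adj c3 c2 by rewrite adj_sym c12 adj_sym.
apply: (subsolution_tree (u := u) (l := [:: u; a; b1; b2; b3; c1; c2; c3])
  (y := [:: 4; 2 * t; 3 * t; 2 * t ^+ 2; t ^+ 3; 3 * t; 2 * t ^+ 2; t ^+ 3])
  (nb := [:: [:: 1; 2; 5]; [:: 0]; [:: 0; 3]; [:: 2; 4]; [:: 3]; [:: 0; 6];
             [:: 5; 7]; [:: 6]]%N)) => //.
do 8![case=> [_|]; first certify]; by [].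
Qed.

Lemma index_ge_E8 (u a b1 b2 c1 c2 c3 c4 c5 : G) :
  uniq [:: u; a; b1; b2; c1; c2; c3; c4; c5] ->
  all (adj u) [:: a; b1; c1] -> adj b1 b2 -> adj c1 c2 -> adj c2 c3 -> adj c3 c4 ->
  adj c4 c5 -> L <= lam.
Proof.
move=> ul /and4P[ua ub uc _] b12 c12 c23 c34 c45.
have [au bu cu] : [/\ adj a u, adj b1 u & adj c1 u] by rewrite !(adj_sym _ u).
have [b21 c21] : adj b2 b1 /\ adj c2 c1 by rewrite adj_sym b12 adj_sym.
have [c32 c43] : adj c3 c2 /\ adj c4 c3 by rewrite adj_sym c23 adj_sym.
have c54 : adj c5 c4 by rewrite adj_sym.
apply: (subsolution_tree (u := u) (l := [:: u; a; b1; b2; c1; c2; c3; c4; c5])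
  (y := [:: 6; 3 * t; 4 * t; 2 * t ^+ 2; 5 * t; 4 * t ^+ 2; 3 * t ^+ 3;
            2 * t ^+ 4; t ^+ 5])
  (nb := [:: [:: 1; 2; 4]; [:: 0]; [:: 0; 3]; [:: 2]; [:: 0; 5]; [:: 4; 6];
             [:: 5; 7]; [:: 6; 8]; [:: 7]]%N)) => //.
do 9![case=> [_|]; first certify]; by [].
Qed.

(* The universal cover carries an affine D diagram along the walk; the mark is
   2 on the walk and 1 on the four extra leaves. *)
Lemma index_ge_nonbacktracking (x : nat -> G) (m : nat) : (0 < m)%N ->
  (forall i, (i < m)%N -> adj (x i) (x i.+1)) ->
  (forall i, (i.+2 <= m)%N -> x i != x i.+2) ->
  (2 < deg (x 0%N))%N -> (2 < deg (x m))%N -> L <= lam.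
Proof.
move=> m_gt0 adj_x nb_x /deg_ge3_avoid-/(_ (x 1%N))[a [b [xa xb a1 b1 ab]]].
move=> /deg_ge3_avoid-/(_ (x m.-1))[c [d [xc xd c1 d1 cd]]].
(* Indices up to [m] follow the walk, and [m + 1] to [m + 4] are the leaves [a], [b], [c], [d];
   [phi] may repeat vertices. *)
pose phi k := if (k <= m)%N then x k else nth a [:: a; b; c; d] (k - m.+1).
(* Damping is measured from [x 0]. In the polynomial form the inequality is an equality except at
   [m], where the excess is [2 * t ^+ m * (1 - t ^+ 2)]. *)
pose y k : R := if (k <= m)%N then 2 * t ^+ k
  else nth 0 [:: t; t; t ^+ m.+1; t ^+ m.+1] (k - m.+1).
pose nb k : seq nat := if k == 0 then [:: 1; m.+1; m.+2]
  else if (k < m)%N then [:: k.-1; k.+1]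
  else if k == m then [:: m.-1; m.+3; m.+4]
  else if (k <= m.+2)%N then [:: 0] else [:: m].
have phi_le k : (k <= m)%N -> phi k = x k by rewrite /phi => ->.
have phi_gt k : phi (k + m.+1)%N = nth a [:: a; b; c; d] k.
  by rewrite /phi leqNgt leq_addl addnK.
have y_le k : (k <= m)%N -> y k = 2 * t ^+ k by rewrite /y => ->.
have y_gt k : y (k + m.+1)%N = nth 0 [:: t; t; t ^+ m.+1; t ^+ m.+1] k.
  by rewrite /y leqNgt leq_addl addnK.
have := (phi_gt 0, phi_gt 1, phi_gt 2, phi_gt 3)%N.
have := (y_gt 0, y_gt 1, y_gt 2, y_gt 3)%N.
rewrite !add0n !add1n !add2n !add3n /= => yE phiE.
clearbody phi y.
apply: (@subsolution_cover _ _ _ alpha_ge0 alpha_lt1 G_gt0 (m + 5) phi y nb).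
- by rewrite addn_gt0 m_gt0.
- move=> k km; have [k_le|k_gt] := leqP k m; first by rewrite y_le // mulr_gt0 ?exprn_gt0.
  have [j -> j4] : exists2 j, k = (j + m.+1)%N & (j < 4)%N.
    by exists (k - m.+1)%N; nat_lia.
  by rewrite y_gt; do 4?[case: j j4 => [|j] j4] => //=; rewrite ?exprn_gt0.
move=> k km; rewrite decay_ineqE // /nb.
have [->|k0] := eqVneq k 0.
  split=> /=.
  - by nat_lia.
  - by rewrite !phiE phi_le // !inE negb_or ab eq_sym a1 eq_sym b1.
  - by rewrite !phiE !phi_le // adj_x // xa xb.
  rewrite !big_cons big_nil !yE !y_le //.
  by have := slack 0%N; lra.
have [k_lt|k_ge] := ltnP k m.
  split=> /=.
  - by nat_lia.
  - rewrite !phi_le ?inE; [|nat_lia|nat_lia]; rewrite andbT.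
    by have := @nb_x k.-1; rewrite prednK ?lt0n //; apply; nat_lia.
  - rewrite !phi_le; [|nat_lia|nat_lia|nat_lia]; rewrite adj_x // !andbT adj_sym.
    by have := @adj_x k.-1; rewrite prednK ?lt0n //; apply; nat_lia.
  rewrite !big_cons big_nil !y_le; [|nat_lia|nat_lia|nat_lia].
  case: k k0 k_lt {km} => // k _ _ /=; rewrite !exprS.
  by have := slack k; lra.
have [->|k_ne] := eqVneq k m.
  split=> /=.
  - by nat_lia.
  - by rewrite !phiE phi_le ?inE ?negb_or; [rewrite cd eq_sym c1 eq_sym d1 | nat_lia].
  - rewrite !phiE !phi_le; [|nat_lia|nat_lia]; rewrite xc xd !andbT adj_sym.
    by have := @adj_x m.-1; rewrite prednK //; apply; nat_lia.
  rewrite !big_cons big_nil !yE !y_le; [|nat_lia|nat_lia].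
  case: (m) m_gt0 => // m' _ /=; rewrite !exprS.
  by have := slack m'; have := slack m'.+1; rewrite exprS; lra.
have [j kE j4] : exists2 j, k = (j + m.+1)%N & (j < 4)%N.
  by exists (k - m.+1)%N; nat_lia.
rewrite {}kE in k0 km k_ge k_ne *.
do 4?[case: j j4 k0 km k_ge k_ne => [|j] j4 k0 km k_ge k_ne] => //.
- have -> : (0 + m.+1 <= m.+2)%N by nat_lia.
  rewrite phi_gt y_gt /= phi_le // adj_sym xa big_cons big_nil y_le //.
  by split=> //=; [nat_lia | rewrite expr0; lra].
- have -> : (1 + m.+1 <= m.+2)%N by nat_lia.
  rewrite phi_gt y_gt /= phi_le // adj_sym xb big_cons big_nil y_le //.
  by split=> //=; [nat_lia | rewrite expr0; lra].
- have -> : (2 + m.+1 <= m.+2)%N = false by nat_lia.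
  rewrite phi_gt y_gt /= phi_le // adj_sym xc big_cons big_nil y_le //.
  by split=> //=; [nat_lia | rewrite [t ^+ m.+1]exprS; lra].
have -> : (3 + m.+1 <= m.+2)%N = false by nat_lia.
rewrite phi_gt y_gt /= phi_le // adj_sym xd big_cons big_nil y_le //.
by split=> //=; [nat_lia | rewrite [t ^+ m.+1]exprS; lra].
Qed.

End Certificates.

(** [giso] asks for a map out of [G], whereas the maps constructed below parametrise [G] by a model
    graph; the inverse is obtained by choice. *)
Lemma giso_of_surj (G H : sgraph) (g : H -> G) : injective g ->
  (forall v, exists x, g x = v) -> (forall x y, adj (g x) (g y) = adj x y) ->
  giso G H.
Proof.
move=> inj_g surj_g adj_g.
have ex_h v : exists x, g x == v by have [x <-] := surj_g v; exists x.
pose h v := xchoose (ex_h v).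
have hK : cancel h g by move=> v; apply/eqP/(xchooseP (ex_h v)).
exists h; first by exists g => // x; apply: inj_g; rewrite hK.
by move=> x y; rewrite -adj_g !hK.
Qed.

(** * Longest paths *)

Section LongestPath.
Variable G : sgraph.
Implicit Types (s t : seq G) (v w : G).

Definition gpath s := uniq s && sorted (@adj G) s.

Definition longest s := gpath s /\ forall t, gpath t -> (size t <= size s)%N.

Lemma longest_exists : exists s, longest s.
Proof.
pose P k := [exists t : k.-tuple G, gpath t].
have exP : exists k, P k by exists 0%N; apply/existsP; exists [tuple].
have ubP k : P k -> (k <= #|G|)%N.
  move=> /existsP[t /andP[ut _]].
  by rewrite -(size_tuple t) -(card_uniqP ut) max_card.
case: (ex_maxnP exP ubP) => k /existsP[t gt] k_max; exists t; split=> // t' gt'.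
by rewrite size_tuple; apply: k_max; apply/existsP; exists (in_tuple t').
Qed.

Lemma gpath_rev s : gpath s -> gpath (rev s).
Proof.
rewrite /gpath rev_uniq rev_sorted => /andP[-> /=].
by rewrite (eq_sorted (e' := @adj G)) // => x y; apply: adj_sym.
Qed.

Lemma longest_rev s : longest s -> longest (rev s).
Proof. by case=> /gpath_rev gs max_s; split=> // t; rewrite size_rev; apply: max_s. Qed.

Lemma longest_gt0 s (x0 : G) : longest s -> (0 < size s)%N.
Proof. by case=> _ /(_ [:: x0]); apply. Qed.

Lemma longest_adj s x0 i : longest s -> (i.+1 < size s)%N ->
  adj (nth x0 s i) (nth x0 s i.+1).
Proof. by case=> /andP[_ /(sortedP x0) +] _; apply. Qed.

Lemma longest_inj s x0 i j : longest s -> (i < size s)%N -> (j < size s)%N ->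
  (nth x0 s i == nth x0 s j) = (i == j).
Proof. by case=> /andP[us _] _ si sj; rewrite nth_uniq. Qed.

(** A path outside [s] that ends next to position [j] can replace the first [j] vertices of [s], so
    it has at most [j] vertices. *)
Lemma longest_detourl s x0 j a t : longest s -> (j < size s)%N ->
  gpath (a :: t) -> ~~ has (mem s) (a :: t) ->
  adj (last a t) (nth x0 s j) -> (size (a :: t) <= j)%N.
Proof.
case=> /andP[us ps] max_s js /andP[ut pt] dis aj.
suff /max_s : gpath ((a :: t) ++ drop j s) by rewrite size_cat size_drop; lia.
apply/andP; split.
  rewrite cat_uniq ut drop_uniq // andbT has_sym.
  by apply: contra dis => /hasP[x xt /mem_drop xs]; apply/hasP; exists x.
rewrite (drop_nth x0 js) /= cat_path /= aj -/(sorted _ (a :: t)) pt /=.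
by have := drop_sorted j ps; rewrite (drop_nth x0 js).
Qed.

(** The bound on the other side of [j] comes from the reversed path. *)
Lemma longest_detour s x0 j a t : longest s -> (j < size s)%N ->
  gpath (a :: t) -> ~~ has (mem s) (a :: t) -> adj (last a t) (nth x0 s j) ->
  (size (a :: t) <= j)%N && (j + size (a :: t) < size s)%N.
Proof.
move=> ls js gt dis aj; rewrite (longest_detourl ls js gt dis aj) /=.
have := @longest_detourl (rev s) x0 (size s - j.+1) a t (longest_rev ls).
rewrite size_rev nth_rev; last by lia.
have -> : (size s - (size s - j.+1).+1 = j)%N by lia.
rewrite (eq_has (a2 := mem s)); last by move=> v; rewrite /= mem_rev.
have sj : (size s - j.+1 < size s)%N by lia.
by move=> /(_ sj gt dis aj) /=; lia.
Qed.

Lemma longest_off s x0 j w : longest s -> (j < size s)%N ->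
  w \notin s -> adj (nth x0 s j) w -> (0 < j)%N && (j.+1 < size s)%N.
Proof.
move=> ls js ws aj; have := @longest_detour s x0 j w [::] ls js.
by rewrite /= orbF addn1 adj_sym; apply.
Qed.

Lemma longest_deg2 s x0 i w : longest s -> (0 < i)%N -> (i.+1 < size s)%N ->
  (deg (nth x0 s i) <= 2)%N -> adj (nth x0 s i) w ->
  w = nth x0 s i.-1 \/ w = nth x0 s i.+1.
Proof.
move=> ls i_gt0 i_lt d2 aw.
suff /orP[/eqP ->|/eqP ->] : (w == nth x0 s i.-1) || (w == nth x0 s i.+1).
- by left.
- by right.
apply: contraTT d2.
rewrite negb_or -ltnNge => /andP[w1 w2].
apply: (@size_le_deg _ _ [:: nth x0 s i.-1; nth x0 s i.+1; w]).
  rewrite /= !inE negb_or eq_sym [_ == w]eq_sym w1 [_ == w]eq_sym w2 !andbT.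
  by rewrite (longest_inj _ ls); lia.
rewrite /= aw longest_adj // adj_sym !andbT.
by have := @longest_adj s x0 i.-1 ls; rewrite prednK //; apply; lia.
Qed.

Lemma longest_chord_cycle s x0 i k : longest s -> (i < k)%N -> (k < size s)%N ->
  adj (nth x0 s i) (nth x0 s k) ->
  exists c, [/\ uniq c, cycle (@adj G) c, size c = (k - i).+1 &
    forall m, (i <= m <= k)%N -> nth x0 s m \in c].
Proof.
case=> /andP[us ps] _ ik ks aik; have si : (i < size s)%N by lia.
pose c := take (k - i).+1 (drop i s).
have sz_c : size c = (k - i).+1 by rewrite size_takel // size_drop; lia.
have c_nth m : (m < (k - i).+1)%N -> nth x0 c m = nth x0 s (i + m).
  by move=> mk; rewrite nth_take // nth_drop.
have uc : uniq c by apply/take_uniq/drop_uniq.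
have pc : sorted (@adj G) c by apply/take_sorted/drop_sorted.
exists c; split=> //; last first.
  move=> m mik; have -> : nth x0 s m = nth x0 c (m - i).
    by rewrite c_nth; [congr nth; lia | lia].
  by apply: mem_nth; rewrite sz_c; lia.
have c0 := c_nth 0 isT; have ck := c_nth (k - i)%N (ltnSn _).
rewrite addn0 in c0; rewrite subnKC in ck; last by lia.
case: (c) sz_c pc c0 ck => // v c' [sz_c] /= pc c0 ck.
by rewrite rcons_path pc /= (last_nth x0) sz_c ck c0 adj_sym.
Qed.

Lemma off_path s : gconnected G -> (0 < size s)%N -> ~~ [forall v, v \in s] ->
  exists2 v, v \in s & exists2 w, w \notin s & adj v w.
Proof.
case: s => // x0 s conG _ ns.
have [/existsP[v /andP[vs /existsP[w /andP[ws vw]]]]|no] :=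
    boolP [exists v, (v \in x0 :: s) && [exists w, (w \notin x0 :: s) && adj v w]].
  by exists v => //; exists w.
case/negP: ns; apply/forallP; apply: (gconnected_ind conG (x0 := x0)).
  by rewrite inE eqxx.
move=> v w vw vs; apply: contraNT no => ws.
by apply/existsP; exists v; rewrite vs; apply/existsP; exists w; rewrite ws.
Qed.

End LongestPath.

Lemma adj_ordE n (G : sgraph) (r : rel 'I_n) (g : 'I_n -> G) :
  (forall i j : 'I_n, (i < j)%N -> adj (g i) (g j) = (r i j || r j i)) ->
  forall i j : 'I_n, adj (g i) (g j) = @adj (graph_of_rel r) i j.
Proof.
move=> gE i j; rewrite -[RHS]/(rel_adj r i j) /rel_adj /= -val_eqE /=.
case: ltngtP => /= [/gE//|/gE ji|/val_inj->]; last by rewrite adj_irr.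
by rewrite adj_sym ji orbC.
Qed.

(** A longest path is spanning, since an edge leaving it would give an inner vertex a third
    neighbour. The only possible edge beyond those of the path joins its two ends. *)
Lemma max_deg2_iso (G : sgraph) : gconnected G -> (0 < #|G|)%N ->
  (forall v : G, deg v <= 2)%N ->
  giso G (path_graph #|G|) \/ (2 < #|G|)%N /\ giso G (cycle_graph #|G|).
Proof.
move=> conG /card_gt0P[x0 _] d2; have [s ls] := longest_exists G.
have s_gt0 := longest_gt0 x0 ls.
have s_all v : v \in s.
  apply/(@forallP G (mem s)): v; apply: contraT.
  case/(off_path conG s_gt0) => v /(nthP x0)[j js <-] [w ws aw].
  have /andP[j_gt0 j_lt] := longest_off ls js ws aw.
  by have [wE|wE] := longest_deg2 ls j_gt0 j_lt (d2 _) aw;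
    rewrite wE mem_nth // in ws; nat_lia.
have sz : size s = #|G|.
  have [/andP[us _] _] := ls; rewrite -(card_uniqP us).
  by apply: eq_card => v; rewrite s_all.
pose p := nth x0 s; pose b := adj (p 0%N) (p (size s).-1).
have pE i j : (i < j)%N -> (j < size s)%N ->
    adj (p i) (p j) = (j == i.+1) || [&& b, i == 0%N & j.+1 == size s].
  move=> ij js; have [->|ji] /= := eqVneq j i.+1.
    by rewrite longest_adj //; nat_lia.
  have si : (i < size s)%N by nat_lia.
  have [i0|i0] /= := eqVneq i 0%N; last first.
    rewrite andbF; apply/negP => /(longest_deg2 ls)[| |||] //; try nat_lia.
      by move/eqP; rewrite (longest_inj _ ls); nat_lia.
    by move/eqP; rewrite (longest_inj _ ls); nat_lia.
  have [jE|jE] := eqVneq j.+1 (size s).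
    by rewrite andbT /b -jE i0.
  rewrite andbF adj_sym i0; apply/negP => /(longest_deg2 ls)[| |||] //; try nat_lia.
    by move/eqP; rewrite (longest_inj _ ls); nat_lia.
  by move/eqP; rewrite (longest_inj _ ls); nat_lia.
have inj_p : injective (fun i : 'I_#|G| => p i).
  move=> i j /eqP; rewrite (longest_inj _ ls) ?sz // => /eqP.
  exact: val_inj.
have surj_p v : exists i : 'I_#|G|, p i = v.
  have iv : (index v s < #|G|)%N by rewrite -sz index_mem.
  by exists (Ordinal iv); apply: nth_index.
(* On two vertices the closing edge [b] is the path edge itself, and the graph counts as a path. *)
have [/andP[bT n_gt2]|nb] := boolP (b && (2 < #|G|)%N).
  right; split=> //.
  apply: (@giso_of_surj G (cycle_graph #|G|) (fun i : 'I_#|G| => p i)) => //.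
  apply: adj_ordE => i j ij.
  have jn : (j < #|G|)%N by [].
  rewrite pE ?sz // bT /= (modn_small (leq_ltn_trans ij jn)).
  rewrite [j == _ :> nat]eq_sym; congr (_ || _).
  move: jn; rewrite leq_eqVlt => /predU1P[jn|jn].
    by rewrite jn modnn eqxx andbT eq_sym.
  rewrite (modn_small jn) (ltn_eqF jn) andbF; apply/esym/eqP => ji.
  by move: ij; rewrite -ji ltnNge leqnSn.
left; apply: (@giso_of_surj G (path_graph #|G|) (fun i : 'I_#|G| => p i)) => //.
apply: adj_ordE => i j ij.
rewrite pE ?sz //; have jn : (j < #|G|)%N by [].
rewrite [j == _ :> nat]eq_sym; have [|ij'] //= := eqVneq i.+1 (j : nat).
have -> : (j.+1 == i :> nat) = false.
  by apply/eqP => ji; move: ij; rewrite -ji ltnNge leqnSn.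
apply: contraNF nb => /and3P[-> /eqP i0 /eqP jE] /=.
by rewrite -jE ltnS; move: ij' ij; rewrite i0; case: (j : nat) => [|[]].
Qed.

(** An induced path [s] and a vertex [q] hanging from its inner position [j] make up [G]: the tree
    with legs of 1, [j] and [size s - j.+1] vertices. *)
Definition broom (G : sgraph) (x0 : G) (s : seq G) (j : nat) (q : G) : Prop :=
  [/\ uniq s /\ q \notin s, forall v, v \in q :: s, (0 < j)%N /\ (j.+1 < size s)%N,
   forall i k, (i < k)%N -> (k < size s)%N ->
     adj (nth x0 s i) (nth x0 s k) = (k == i.+1) &
   forall i, (i < size s)%N -> adj q (nth x0 s i) = (i == j)].

(** * Graphs of index below [L] with a vertex of degree at least 3 *)

Section Broom.
Variables (R : realType) (G : sgraph) (alpha t L : R).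
Hypotheses (alpha_ge0 : 0 <= alpha) (alpha_lt1 : alpha < 1).
Hypotheses (t_gt0 : 0 < t) (t_le1 : t <= 1).
Hypothesis alpha_t : alpha * t = (1 - alpha) * (1 - t ^+ 2).
Hypothesis L_t : L * t = (1 - alpha) * (3 - t ^+ 2).
Hypothesis G_gt0 : (0 < #|G|)%N.
Local Notation lam := (Aalpha_index G alpha).

(** Going once round the cycle is a walk from [v] to itself, nonbacktracking because the cycle has
    at least three vertices. *)
Lemma index_ge_cycle (c : seq G) (v : G) : uniq c -> cycle (@adj G) c ->
  (2 < size c)%N -> v \in c -> (2 < deg v)%N -> L <= lam.
Proof.
move=> uc cc sz vc dv; have [i c' cE] := rot_to vc.
have sz' : size c = (size c').+1 by rewrite -(size_rot i) cE.
move: uc cc; rewrite -(rot_uniq i) -(rot_cycle i) cE => uc /= /(pathP v) pc.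
pose x k := nth v (v :: rcons c' v) k.
have x_in k : (k <= size c')%N -> x k = nth v (v :: c') k.
  by case: k => // k ks; rewrite /x /= nth_rcons ks.
have x_last : x (size c') .+1 = v by rewrite /x /= nth_rcons ltnn eqxx.
apply: (index_ge_nonbacktracking alpha_ge0 alpha_lt1 t_gt0 t_le1 alpha_t L_t G_gt0
  (x := x) (m := (size c').+1)) => //.
- by move=> k ks; apply: pc; rewrite size_rcons.
- move=> k ks; rewrite x_in; last by nat_lia.
  have [kE|kE] := eqVneq k.+1 (size c').
    rewrite kE x_last -[X in _ != X]/(nth v (v :: c') 0) nth_uniq //=.
      by move: sz; rewrite sz' -kE; case: (k).
    exact: ltnW.
  have ks' : (k.+2 <= size c')%N by rewrite ltn_neqAle kE.
  rewrite x_in // nth_uniq //=; last exact: ltnW.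
  by rewrite neq_ltn (leqnSn k.+1).
by rewrite x_last.
Qed.

(** Take a longest path [s]. Every deviation from a path with one pendant vertex contradicts the
    maximality of [s] or yields a certificate for [L <= lam]. *)
Lemma broom_exists : gconnected G -> lam < L -> (exists v : G, (2 < deg v)%N) ->
  exists x0 s j q, @broom G x0 s j q.
Proof.
move=> conG lamL [x0 dx0]; have [s ls] := longest_exists G.
have not_le : ~ L <= lam by rewrite leNgt lamL.
have s_gt0 := longest_gt0 x0 ls; pose p := nth x0 s.
have inj_p i k : (i < size s)%N -> (k < size s)%N -> (p i == p k) = (i == k).
  exact: longest_inj.
have p_in i : (i < size s)%N -> p i \in s by apply: mem_nth.
have adj_p i : (i.+1 < size s)%N -> adj (p i) (p i.+1) by apply: longest_adj.
have adj_p' i : (0 < i)%N -> (i < size s)%N -> adj (p i) (p i.-1).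
  by case: i => // i _ /adj_p; rewrite adj_sym.
(* Either [s] is spanning and contains [x0], or an edge leaves [s] at an inner vertex, which then
   has a third neighbour. *)
have [j js dj] : exists2 j, (j < size s)%N & (2 < deg (p j))%N.
  have [/forallP s_all|] := boolP [forall v, v \in s].
    exists (index x0 s); first by rewrite index_mem s_all.
    by rewrite /p nth_index.
  case/(off_path conG s_gt0) => v /(nthP x0)[j js <-] [w ws aw].
  have /andP[j_gt0 j_lt] := longest_off ls js ws aw.
  exists j => //; apply: (@size_le_deg _ _ [:: p j.-1; p j.+1; w]).
    rewrite /= !inE negb_or inj_p ?andbT; [|nat_lia|nat_lia].
    rewrite -andbA; apply/and3P; split; first by nat_lia.
      by apply: contraNneq ws => <-; apply: p_in; nat_lia.
    by apply: contraNneq ws => <-; apply: p_in; nat_lia.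
  by rewrite /= aw adj_p // adj_p'.
(* The segment of [s] between two vertices of degree at least 3 is a nonbacktracking walk. *)
have uniq_j i : (i < size s)%N -> (2 < deg (p i))%N -> i = j.
  suff key a b : (a < b)%N -> (b < size s)%N -> (2 < deg (p a))%N ->
      (2 < deg (p b))%N -> False.
    move=> si di; case: (ltngtP i j) => // [ij|ji].
      by case: (key i j).
    by case: (key j i).
  move=> ab bs da db; apply: not_le.
  apply: (index_ge_nonbacktracking alpha_ge0 alpha_lt1 t_gt0 t_le1 alpha_t L_t G_gt0
    (x := fun k => p (a + k)%N) (m := (b - a)%N)).
  - by nat_lia.
  - by move=> k kb; rewrite addnS; apply: adj_p; nat_lia.
  - by move=> k kb; rewrite inj_p; nat_lia.
  - by rewrite addn0.
  - by rewrite subnKC // ltnW.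
(* A chord closes a cycle, whose vertices must have degree at most 2. If one end of the chord is
   inner to [s], that end has a third neighbour; otherwise the cycle passes through [p j]. *)
have no_chord i k : (i.+1 < k)%N -> (k < size s)%N -> adj (p i) (p k) = false.
  move=> ik ks; apply/negP => aik.
  have [c [uc cc sz_c cE]] := longest_chord_cycle ls (ltnW ik) ks aik.
  have cyc m : (i <= m <= k)%N -> (2 < deg (p m))%N -> False.
    by move=> /cE mc dm; apply: not_le; apply: (index_ge_cycle uc cc _ mc dm); rewrite sz_c; nat_lia.
  have deg2 m : (i <= m <= k)%N -> (deg (p m) <= 2)%N.
    by move=> mik; rewrite leqNgt; apply/negP; apply: cyc.
  have nb_p a b : (0 < a)%N -> (a.+1 < size s)%N -> (b < size s)%N ->
      (deg (p a) <= 2)%N -> adj (p a) (p b) -> b = a.-1 \/ b = a.+1.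
    move=> a0 sa sb da /(longest_deg2 ls a0 sa da)[] /eqP.
      by rewrite inj_p ?prednK // 1?ltnW // => [/eqP|]; [left | exact: ltnW].
    by rewrite inj_p // => /eqP; right.
  have [i0|i0] := posnP i; last first.
    have si : (i.+1 < size s)%N by nat_lia.
    have ii : (i <= i <= k)%N by nat_lia.
    by case: (nb_p i k i0 si ks (deg2 i ii) aik); nat_lia.
  have [kE|kE] := eqVneq k.+1 (size s).
    by apply: (cyc j) => //; rewrite i0 /= -ltnS kE.
  rewrite adj_sym in aik; have k0 : (0 < k)%N by nat_lia.
  have sk : (k.+1 < size s)%N by nat_lia.
  have si : (i < size s)%N by nat_lia.
  have kk : (i <= k <= k)%N by nat_lia.
  by case: (nb_p k i k0 sk si (deg2 k kk) aik); nat_lia.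
have adj_pE i k : (i < k)%N -> (k < size s)%N -> adj (p i) (p k) = (k == i.+1).
  move=> ik ks; have [kE|kE] := eqVneq k i.+1; first by rewrite kE adj_p // -kE.
  by rewrite no_chord //; nat_lia.
have adj_on w : w \in s -> adj (p j) w -> w = p j.-1 \/ w = p j.+1.
  move=> /(nthP x0)[k ks <-]; rewrite -/(p k); case: (ltngtP j k) => [jk|kj|->].
  - by rewrite adj_pE // => /eqP ->; right.
  - by rewrite adj_sym adj_pE // => /eqP ->; left.
  - by rewrite adj_irr.
have [q qs aq] : exists2 q, q \notin s & adj (p j) q.
  have [a [b [aa ab a1 b1 aNb]]] := deg_ge3_avoid (p j.+1) dj.
  have [sa|] := boolP (a \in s); last by exists a.
  have [sb|] := boolP (b \in s); last by exists b.
  have [aE|aE] := adj_on a sa aa; last by rewrite aE eqxx in a1.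
  have [bE|bE] := adj_on b sb ab; last by rewrite bE eqxx in b1.
  by rewrite aE bE eqxx in aNb.
have /andP[j_gt0 j_lt] := longest_off ls js qs aq.
have pNq i : (i < size s)%N -> p i != q.
  by move=> si; apply: contraNneq qs => <-; apply: p_in.
(* A fourth neighbour of [p j] would complete the star. *)
have adj_j w : adj (p j) w -> w \in [:: p j.-1; p j.+1; q].
  move=> aw; apply: contraT; rewrite !inE !negb_or => /and3P[w1 w2 w3].
  case: not_le; apply: (index_ge_star4 alpha_ge0 alpha_lt1 t_gt0 t_le1 alpha_t L_t G_gt0
    (u := p j) (a := p j.-1) (b := p j.+1) (c := q) (d := w)); last first.
    by rewrite /= adj_p // adj_p' // aq aw.
  have jw : p j != w by apply: contraTneq aw => <-; rewrite adj_irr.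
  rewrite /= !inE !negb_or !inj_p ?pNq ?jw //=; try nat_lia.
  by rewrite ![_ == w]eq_sym w1 w2 w3; nat_lia.
(* Another neighbour of [q] on [s] would be a second vertex of [s] with degree at least 3. *)
have adj_q i : (i < size s)%N -> adj q (p i) = (i == j).
  move=> si; have [->|ij] := eqVneq i j; first by rewrite adj_sym.
  apply/negP; rewrite adj_sym => aiq.
  have /andP[i_gt0 i_lt] := longest_off ls si qs aiq.
  have di : (deg (p i) <= 2)%N.
    by rewrite leqNgt; apply: contraNN ij => di; rewrite (uniq_j i).
  have [qE|qE] := longest_deg2 ls i_gt0 i_lt di aiq.
    by move: (pNq i.-1); rewrite qE eqxx => /(_ (leq_ltn_trans (leq_pred i) si)).
  by move: (pNq i.+1 i_lt); rewrite qE eqxx.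
(* A vertex [w] behind [q] gives a detour of two vertices, so maximality leaves two vertices of [s]
   on each side of [p j] and E6 appears. *)
have leaf_q w : adj q w -> w \in s.
  move=> aqw; apply: contraT => ws.
  have wq : w != q by apply: contraTneq aqw => ->; rewrite adj_irr.
  have := @longest_detour _ s x0 j w [:: q] ls js.
  rewrite /gpath /= !inE wq adj_sym aqw (negPf ws) (negPf qs) adj_sym aq.
  move=> /(_ isT isT isT) /andP[j2 sj2]; case: not_le.
  have pw i : (i < size s)%N -> p i != w.
    by move=> si; apply: contraNneq ws => <-; apply: p_in.
  apply: (index_ge_E6 alpha_ge0 alpha_lt1 t_gt0 t_le1 alpha_t L_t G_gt0 (u := p j)
    (a1 := p j.-1) (a2 := p j.-2) (b1 := p j.+1) (b2 := p j.+2) (c1 := q)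
    (c2 := w)) => //.
  - rewrite /= !inE !negb_or !inj_p ?pNq ?pw //=; try nat_lia.
    by rewrite [q == w]eq_sym wq; nat_lia.
  - by rewrite /= adj_p // adj_p' // aq.
  - by apply: adj_p'; nat_lia.
  - by apply: adj_p; nat_lia.
exists x0, s, j, q; split=> //.
  by split=> //; have [/andP[]] := ls.
(* By connectedness it suffices that [q :: s] is closed under adjacency. *)
apply/forallP/forallP; apply: (gconnected_ind conG (x0 := q)).
  by rewrite inE eqxx.
move=> v w vw; rewrite !inE => /predU1P[vq|/(nthP x0)[i si vi]].
  by rewrite leaf_q ?orbT // -vq.
have [->|wq] //= := eqVneq w q; apply: contraT => ws.
have aiw : adj (p i) w by rewrite /p vi.
have /andP[i_gt0 i_lt] := longest_off ls si ws aiw.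
have [ij|ij] := eqVneq i j.
  move: (aiw); rewrite ij => /adj_j; rewrite !inE (negPf wq) orbF.
  by case/orP => /eqP wE; rewrite wE p_in // in ws; nat_lia.
have di : (deg (p i) <= 2)%N.
  by rewrite leqNgt; apply: contraNN ij => di; rewrite (uniq_j i).
have [wE|wE] := longest_deg2 ls i_gt0 i_lt di aiw.
  by move: ws; rewrite wE p_in // (leq_ltn_trans (leq_pred i) si).
by move: ws; rewrite wE p_in.
Qed.

End Broom.

(** A path graph given by a listing of its vertices, so that it can be reversed. *)
Definition path_like (P : sgraph) (x0 : P) (s : seq P) : Prop :=
  [/\ uniq s, forall v, v \in s & forall i k, (i < size s)%N -> (k < size s)%N ->
    adj (nth x0 s i) (nth x0 s k) = (k == i.+1) || (i == k.+1)].

Lemma path_like_rev (P : sgraph) (x0 : P) s : path_like x0 s -> path_like x0 (rev s).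
Proof.
case=> us s_all adj_s; split=> [|v|i k]; rewrite ?rev_uniq ?mem_rev //.
by rewrite size_rev => si sk; rewrite !nth_rev // adj_s; nat_lia.
Qed.

Lemma path_graph_like n (x0 : path_graph n) : path_like x0 (enum 'I_n).
Proof.
split=> [|v|i k]; rewrite ?enum_uniq ?mem_enum // size_enum_ord => ni nk.
rewrite -[LHS]/(rel_adj _ _ _) /rel_adj /= -val_eqE /= !nth_enum_ord //.
by nat_lia.
Qed.

Lemma deg_le_size (G : sgraph) (v : G) (s : seq G) :
  (forall w, adj v w -> w \in s) -> (deg v <= size s)%N.
Proof.
move=> sE; apply: leq_trans (card_size s).
by apply/subset_leq_card/fintype.subsetP => w; apply: sE.
Qed.

Lemma Aop_const1 (R : realType) (G : sgraph) (alpha : R) (v : G) :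
  Aop alpha (fun=> 1) v = (deg v)%:R.
Proof.
rewrite /Aop mulr1 (_ : \sum_(w | _) _ = (deg v)%:R); first by ring.
by rewrite /deg -sum1_card natr_sum.
Qed.

(** Once a concave sequence descends, it descends up to [d]; before that it has only risen from
    [x 1], which is at least [x d]. *)
Lemma concave_ge (R : realDomainType) (x : nat -> R) (d j : nat) :
  (forall i, (0 < i)%N -> (i < d)%N -> x i.-1 + x i.+1 <= 2 * x i) ->
  x d <= x 1%N -> (0 < j)%N -> (j <= d)%N -> x d <= x j.
Proof.
move=> conc xd1; elim: j => // j IHj _ jd; have [j0|j_gt0] := posnP j.
  by rewrite j0.
have [le_j|/ltW ge_j] := lerP (x j) (x j.+1).
  by apply: le_trans le_j; apply: IHj => //; apply: ltnW.
have dec i : (j + i < d)%N -> x (j + i).+1 <= x (j + i)%N.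
  elim: i => [|i IHi]; first by rewrite addn0.
  rewrite addnS => lt_i; have := conc _ (ltn0Sn _) lt_i.
  by have := IHi (ltnW lt_i); rewrite /=; lra.
have le_i i : (j.+1 + i <= d)%N -> x (j.+1 + i)%N <= x j.+1.
  elim: i => [|i IHi]; first by rewrite addn0.
  rewrite addnS => lt_i; apply: le_trans (IHi (ltnW lt_i)).
  by have := dec i.+1; rewrite -addSnnS; apply.
by have := le_i (d - j.+1)%N; rewrite subnKC //; apply.
Qed.

(** * The index of a path, and its growth under moving an end vertex *)

Section PathIndex.
Variables (R : realType) (alpha : R).
Hypotheses (alpha_ge0 : 0 <= alpha) (alpha_lt1 : alpha < 1).

(** The constant 1 is a supersolution for 2, strict at an end vertex. *)
Lemma path_like_index_lt2 (P : sgraph) (x0 : P) s : gconnected P ->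
  path_like x0 s -> Aalpha_index P alpha < 2.
Proof.
move=> conP [us s_all adj_s]; pose p := nth x0 s.
have P_gt0 : (0 < #|P|)%N by apply/card_gt0P; exists x0.
have s_gt0 : (0 < size s)%N by case: (s) (s_all x0).
apply: (supersolution_lt alpha_ge0 alpha_lt1 P_gt0 conP (f := fun=> 1)) => //.
- move=> v; rewrite Aop_const1 mulr1 ler_nat.
  have /(nthP x0)[i si <-] := s_all v.
  apply: (@deg_le_size _ _ [:: p i.-1; p i.+1]) => w.
  have /(nthP x0)[k sk <-] := s_all w; rewrite adj_s // => /orP[]/eqP -> /=.
    by rewrite !inE eqxx orbT.
  by rewrite inE eqxx.
exists (p 0%N); rewrite Aop_const1 mulr1 ltr_nat ltnS.
apply: (@deg_le_size _ _ [:: p 1%N]) => w.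
have /(nthP x0)[k sk <-] := s_all w; rewrite adj_s // => /orP[]/eqP // ->.
by rewrite inE eqxx.
Qed.

(** Carry the Perron vector of the path over to [G], moving its last entry to [q]. The edge gained
    at [j] contributes at least as much as the edge lost at [d], because [x d <= x j]. *)
Lemma broom_index_gt (P G : sgraph) (y0 : P) s' (x0 : G) s j q : gconnected P ->
  path_like y0 s' -> broom x0 s j q -> size s' = (size s).+1 ->
  Aalpha_index P alpha < Aalpha_index G alpha.
Proof.
move=> conP like_s' br_s sz'.
have k_gt0 : 0 < 1 - alpha by rewrite subr_gt0.
have P_gt0 : (0 < #|P|)%N by apply/card_gt0P; exists y0.
have G_gt0 : (0 < #|G|)%N by apply/card_gt0P; exists x0.
have [f f_gt0 fA] := perron alpha_ge0 alpha_lt1 P_gt0 conP.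
have := path_like_index_lt2 conP like_s'.
move: (Aalpha_index P alpha) fA => lam fA lam2.
(* Orient the path so that the concave profile [x] is smallest, among the
   inner vertices, next to the end being cut off. *)
have [s1 [us1 s1_all adj_s1] [sz1 le_x]] : exists2 s1, path_like y0 s1 &
    size s1 = size s' /\ f (nth y0 s1 (size s).-1) <= f (nth y0 s1 1%N).
  have [le|/ltW ge] := lerP (f (nth y0 s' (size s).-1)) (f (nth y0 s' 1%N)).
    by exists s'.
  have [_ _ [_ j_lt] _ _] := br_s.
  exists (rev s'); [exact: path_like_rev | split; first by rewrite size_rev].
  rewrite !nth_rev sz'; [|nat_lia|nat_lia].
  have -> : ((size s).+1 - (size s).-1.+1 = 1)%N by nat_lia.
  by have -> : ((size s).+1 - 2 = (size s).-1)%N by nat_lia.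
have [[us qs] s_all [j_gt0 j_lt] adj_s adj_q] := br_s.
rewrite sz' in sz1; pose x i := f (nth y0 s1 i); pose d := (size s).-1.
have dE : size s = d.+1 by rewrite /d; nat_lia.
have sz1E : size s1 = d.+2 by rewrite sz1 dE.
have x_gt0 i : 0 < x i by apply: f_gt0.
have inner i : (0 < i)%N -> (i <= d)%N ->
    lam * x i = alpha * 2 * x i + (1 - alpha) * (x i.-1 + x i.+1).
  move=> i0 id; rewrite /x -fA (@Aop_nbE _ _ _ _ _ [:: nth y0 s1 i.-1; nth y0 s1 i.+1]).
  - by rewrite !big_cons big_nil addr0.
  - by rewrite /= inE nth_uniq ?sz1E //; nat_lia.
  move=> w; have /(nthP y0)[k sk <-] := s1_all w; rewrite sz1E in sk.
  by rewrite adj_s1 ?sz1E ?inE ?nth_uniq ?sz1E //; nat_lia.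
have left_end : lam * x 0%N = alpha * x 0%N + (1 - alpha) * x 1%N.
  rewrite /x -fA (@Aop_nbE _ _ _ _ _ [:: nth y0 s1 1%N]) ?big_cons ?big_nil ?addr0 ?mulr1 //.
  move=> w; have /(nthP y0)[k sk <-] := s1_all w; rewrite sz1E in sk.
  by rewrite adj_s1 ?sz1E ?inE ?nth_uniq ?sz1E //; nat_lia.
have right_end : lam * x d.+1 = alpha * x d.+1 + (1 - alpha) * x d.
  rewrite /x -fA (@Aop_nbE _ _ _ _ _ [:: nth y0 s1 d]) ?big_cons ?big_nil ?addr0 ?mulr1 //.
  move=> w; have /(nthP y0)[k sk <-] := s1_all w; rewrite sz1E in sk.
  by rewrite adj_s1 ?sz1E ?inE ?nth_uniq ?sz1E //; nat_lia.
have jd : (j < d)%N by nat_lia.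
(* Concavity at inner vertices is the eigenvalue equation together with [lam < 2]. *)
have xdj : x d <= x j.
  apply: (concave_ge (d := d)) => // [i i0 id|]; last exact: ltnW.
  have := inner i i0 (ltnW id); rewrite -(ler_pM2l k_gt0) => E.
  have : (2 - lam) * x i >= 0 by apply: mulr_ge0; rewrite ?subr_ge0 ltW.
  by lra.
clear fA adj_s1 s1_all us1 le_x f_gt0.
(* Positions 0 to [d] keep their entries; the cut vertex [d.+1] becomes [q]. *)
pose p := nth x0 s; pose z v := if v == q then x d.+1 else x (index v s).
have zq : z q = x d.+1 by rewrite /z eqxx.
have pNq i : (i <= d)%N -> p i != q.
  by move=> id; apply: contraNneq qs => <-; apply: mem_nth; rewrite dE.
have zp i : (i <= d)%N -> z (p i) = x i.
  by move=> id; rewrite /z (negPf (pNq i id)) index_uniq // dE.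
have z_gt0 v : 0 < z v by rewrite /z; case: ifP.
have z_ge0 v : 0 <= z v by rewrite ltW.
have inj_p i k : (i <= d)%N -> (k <= d)%N -> (p i == p k) = (i == k).
  by move=> id kd; rewrite nth_uniq // dE.
have adj_p i : (i < d)%N -> adj (p i) (p i.+1).
  by move=> id; rewrite adj_s ?eqxx // dE.
have adj_p' i : (0 < i)%N -> (i <= d)%N -> adj (p i) (p i.-1).
  by case: i => // i _ id; rewrite adj_sym adj_p.
(* The contribution of [v] to the Rayleigh defect of [z]: nonnegative away from [p j] and [p d],
   with the gain at [p j] covering the loss at [p d]. *)
pose F v := z v * (Aop alpha z v - lam * z v).
have F_ge0 v : v != p j -> v != p d -> 0 <= F v.
  move=> vj vd; rewrite mulr_ge0 // subr_ge0.
  have := s_all v; rewrite inE => /predU1P[->|/(nthP x0)[i]].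
    have adj_qj : adj q (p j) by rewrite adj_q ?eqxx // dE ltnW.
    have := @Aop_nb_ge _ _ _ alpha_ge0 alpha_lt1 z q [:: p j] z_ge0 isT.
    rewrite /= adj_qj !big_cons big_nil addr0 zq zp ?(ltnW jd) // => /(_ isT).
    apply: le_trans; rewrite right_end mulr1 lerD2l.
    by rewrite ler_pM2l.
  rewrite dE ltnS => id vi; rewrite -{}vi -/(p i) in vj vd *.
  rewrite inj_p ?(ltnW jd) // in vj; rewrite inj_p // in vd.
  have [i0|i0] := posnP i.
    have := @Aop_nb_ge _ _ _ alpha_ge0 alpha_lt1 z (p i) [:: p i.+1] z_ge0 isT.
    rewrite /= adj_p ?big_cons ?big_nil ?addr0 ?zp; [|nat_lia..].
    by move=> /(_ isT); rewrite i0 left_end mulr1.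
  have := @Aop_nb_ge _ _ _ alpha_ge0 alpha_lt1 z (p i) [:: p i.-1; p i.+1] z_ge0.
  rewrite /= inE inj_p ?adj_p ?adj_p' ?big_cons ?big_nil ?addr0 ?zp; [|nat_lia..].
  by rewrite inner //; apply; nat_lia.
have F_j : x j * (alpha * x j + (1 - alpha) * x d.+1) <= F (p j).
  have := @Aop_nb_ge _ _ _ alpha_ge0 alpha_lt1 z (p j) [:: p j.-1; p j.+1; q] z_ge0.
  rewrite /= !inE !negb_or inj_p ?pNq ?adj_p ?adj_p' ?big_cons ?big_nil ?addr0 ?zp ?zq;
    [|nat_lia..].
  rewrite adj_sym adj_q ?eqxx ?dE ?ltnS ?(ltnW jd) // => H.
  have {}H : alpha * 3 * x j + (1 - alpha) * (x j.-1 + (x j.+1 + x d.+1)) <=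
      Aop alpha z (p j) by apply: H => //; nat_lia.
  rewrite /F zp ?(ltnW jd) // ler_pM2l // inner ?(ltnW jd) //.
  by lra.
have Aop_d : Aop alpha z (p d) = alpha * x d + (1 - alpha) * x d.-1.
  have d_gt0 : (0 < d)%N by nat_lia.
  rewrite (@Aop_nbE _ _ _ _ _ [:: p d.-1]) // ?big_cons ?big_nil ?addr0 ?mulr1.
    by rewrite !zp // leq_pred.
  move=> w; have := s_all w; rewrite !inE => /predU1P[->|/(nthP x0)[i]].
    rewrite adj_sym adj_q ?dE // [q == _]eq_sym (negPf (pNq _ (leq_pred d))).
    by nat_lia.
  rewrite dE ltnS => id <-; rewrite -/(p i) inj_p ?leq_pred //.
  move: id; rewrite leq_eqVlt => /predU1P[->|id].
    by rewrite adj_irr; nat_lia.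
  by rewrite adj_sym adj_s ?dE //; nat_lia.
have F_d : F (p d) = - (x d * (alpha * x d + (1 - alpha) * x d.+1)).
  by rewrite /F Aop_d zp // inner //; [ring | nat_lia].
have rayleigh : lam * \sum_v z v * z v <= \sum_v z v * Aop alpha z v.
  rewrite -subr_ge0 mulr_sumr -sumrB.
  rewrite (eq_bigr F); last by move=> v _; rewrite /F; ring.
  rewrite (bigD1 (p j)) //= (bigD1 (p d)) /=; last first.
    by rewrite inj_p ?(ltnW jd) //; nat_lia.
  rewrite addrA addr_ge0 //; last first.
    by apply: sumr_ge0 => v /andP[vj vd]; apply: F_ge0.
  rewrite F_d subr_ge0; apply: le_trans F_j.
  apply: ler_pM => //; rewrite ?addr_ge0 ?mulr_ge0 ?(ltW (x_gt0 _)) ?(ltW k_gt0) //.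
  by rewrite lerD2r ler_wpM2l.
(* If the index did not increase, [z] would be an eigenvector, but its defect at [p d] is strictly
   negative. *)
rewrite ltNge; apply/negP => le_lam.
have z_nz : exists v, z v != 0 by exists q; rewrite gt_eqF.
have ge_lam := rayleigh_lower G_gt0 z_nz rayleigh.
have lamE : Aalpha_index G alpha = lam by apply/eqP; rewrite eq_le le_lam.
have := rayleigh_lower_eq G_gt0 rayleigh le_lam (p d).
rewrite lamE => E; have := F_d; rewrite /F E subrr mulr0 => /esym/eqP.
rewrite oppr_eq0 gt_eqF // mulr_gt0 // ltr_wpDl ?mulr_gt0 //.
by rewrite mulr_ge0 // ltW.
Qed.

End PathIndex.

(** * Independent sets *)

Section IndependenceNumber.
Variable G : sgraph.
Implicit Types S Z : {set G}.

Lemma independentP S :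
  reflect (forall x y, x \in S -> y \in S -> adj x y = false) (independent S).
Proof.
apply: (iffP forall_inP) => [indS x y xS yS|indS x xS].
  by have /forall_inP/(_ y yS)/negbTE := indS x xS.
by apply/forall_inP => y yS; rewrite indS.
Qed.

Lemma indep_num_ge S : independent S -> (#|S| <= indep_num G)%N.
Proof. by move=> indS; apply: (@leq_bigmax_cond _ _ (fun S : {set G} => #|S|)). Qed.

Lemma indep_num_le k : (forall S : {set G}, independent S -> (#|S| <= k)%N) ->
  (indep_num G <= k)%N.
Proof. by move=> le_k; apply/bigmax_leqP. Qed.

Lemma indep_num_ex : exists2 S : {set G}, independent S & #|S| = indep_num G.
Proof.
have [|S indS SE] := @eq_bigmax_cond _ [pred S : {set G} | @independent G S] (fun S => #|S|).
  apply/card_gt0P; exists set0; rewrite inE; apply/independentP => x y.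
  by rewrite inE.
by exists S => //; rewrite -SE.
Qed.

Lemma independent1 (x : G) : @independent G [set x].
Proof. by apply/independentP => y z /set1P-> /set1P->; apply: adj_irr. Qed.

(* Greedily pick a vertex with at most one remaining neighbour and discard that
   neighbour. *)
Lemma degenerate_indep_num :
  (forall Z, Z != set0 -> exists2 v, v \in Z & (#|[set w in Z | adj v w]| <= 1)%N) ->
  (#|G| <= 2 * indep_num G)%N.
Proof.
move=> degen.
suff key n (Z : {set G}) : (#|Z| <= n)%N ->
    exists S, [/\ S \subset Z, @independent G S & (#|Z| <= 2 * #|S|)%N].
  have [S [_ /indep_num_ge indS]] := key #|G| [set: G] (max_card _).
  by rewrite cardsT => /leq_trans; apply; rewrite leq_mul2l.
elim: n Z => [|n IHn] Z Zn.
  exists set0; rewrite sub0set (leq_trans Zn) //; split=> //.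
  by apply/independentP => x y; rewrite inE.
have [->|/degen[v vZ dv]] := eqVneq Z set0.
  exists set0; rewrite sub0set cards0; split=> //.
  by apply/independentP => x y; rewrite inE.
pose N := v |: [set w in Z | adj v w].
have NZ : N \subset Z.
  by apply/fintype.subsetP => w; rewrite !inE => /predU1P[->|/andP[]].
have N2 : (#|N| <= 2)%N by rewrite /N cardsU1 addnC -addn1 leq_add ?leq_b1.
have N1 : (0 < #|N|)%N by apply/card_gt0P; exists v; rewrite !inE eqxx.
have cardZ : (#|Z :\: N| + #|N| = #|Z|)%N.
  by rewrite addnC -(cardsID N Z) (setIidPr NZ).
have [|S [SZ indS le_S]] := IHn (Z :\: N).
  by rewrite -ltnS; apply: leq_trans Zn; rewrite -cardZ -addn1 leq_add2l.
have SN w : w \in S -> [/\ w != v, w \in Z & adj v w = false].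
  move=> /(fintype.subsetP SZ); rewrite !inE negb_or => /andP[/andP[wv nw] wZ].
  by move: nw; rewrite wZ => /negbTE.
have vS : v \notin S by apply/negP => /SN[]; rewrite eqxx.
exists (v |: S); split.
- by apply/fintype.subsetP => w; rewrite !inE => /predU1P[->|/SN[]].
- apply/independentP => x y; rewrite !inE.
  case/predU1P=> [->|xS]; case/predU1P=> [->|yS].
  + exact: adj_irr.
  + by have [] := SN y yS.
  + by rewrite adj_sym; have [] := SN x xS.
  + by have /independentP := indS; apply.
- rewrite cardsU1 vS -cardZ mulnDr addnC muln1.
  by rewrite leq_add.
Qed.

End IndependenceNumber.

(** * Connectedness, independence numbers and degrees of the extremal graphs *)

Lemma giso_sym (G H : sgraph) : giso G H -> giso H G.
Proof.
case=> f [g fK gK] adj_f; exists g; first by exists f.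
by move=> x y; rewrite -adj_f !gK.
Qed.

Lemma giso_indep_num (G H : sgraph) : giso G H -> indep_num G = indep_num H.
Proof.
suff le_iso (A B : sgraph) : giso A B -> (indep_num A <= indep_num B)%N.
  move=> isoGH; apply/eqP; rewrite eqn_leq (le_iso _ _ isoGH).
  exact/le_iso/giso_sym.
case=> f /bij_inj inj_f adj_f; apply: indep_num_le => S /independentP indS.
rewrite -(card_imset _ inj_f); apply: indep_num_ge; apply/independentP.
by move=> _ _ /imsetP[x xS ->] /imsetP[y yS ->]; rewrite adj_f indS.
Qed.

Lemma graph_of_relE (V : finType) (r : rel V) (x y : V) :
  @adj (graph_of_rel r) x y = (x != y) && (r x y || r y x).
Proof. by []. Qed.

Lemma ord_graphE n (r : rel 'I_n) (i j : 'I_n) :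
  @adj (graph_of_rel r) i j = (i != j :> nat) && (r i j || r j i).
Proof. by []. Qed.

Lemma gconnected_root (G : sgraph) (x0 : G) :
  (forall v, connect (@adj G) x0 v) -> gconnected G.
Proof.
move=> root_con x y; apply: connect_trans (root_con y).
by rewrite (sym_connect_sym (@adj_sym G)).
Qed.

Lemma path_graph_connected n : gconnected (path_graph n).
Proof.
case: n => [[]//|n]; apply: (@gconnected_root (path_graph n.+1) ord0) => v.
case: v => k kn; elim: k kn => [|k IHk] kn.
  by rewrite (_ : Ordinal kn = ord0) ?connect0 //; apply: val_inj.
apply: connect_trans (IHk (ltnW kn)) _; apply: connect1.
by rewrite ord_graphE /= eqxx neq_ltn leqnn.
Qed.

Lemma cycle_graph_connected n : gconnected (cycle_graph n).
Proof.
case: n => [[]//|n]; apply: (@gconnected_root (cycle_graph n.+1) ord0) => v.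
case: v => k kn; elim: k kn => [|k IHk] kn.
  by rewrite (_ : Ordinal kn = ord0) ?connect0 //; apply: val_inj.
apply: connect_trans (IHk (ltnW kn)) _; apply: connect1.
by rewrite ord_graphE /= modn_small // eqxx neq_ltn leqnn.
Qed.

Lemma T_graph11_connected m : gconnected (T_graph 1 1 m).
Proof.
apply: (@gconnected_root (T_graph 1 1 m) None) => -[[[i|i]|[k km]]|].
- by apply: connect1; rewrite graph_of_relE /= ord1.
- by apply: connect1; rewrite graph_of_relE /= ord1.
- elim: k km => [|k IHk] km; first by apply: connect1; rewrite graph_of_relE.
  apply: connect_trans (IHk (ltnW km)) _; apply: connect1.
  rewrite graph_of_relE /= eqxx andbT.
  by apply/eqP => -[] /n_Sn.
- exact: connect0.
Qed.

(** Positions [2 k] and [2 k + 1] form an edge, so an independent set contains at most one of them;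
    this bounds independent sets in the path and in the long leg. *)
Lemma half_eq_adj (a b : nat) : a != b -> a./2 = b./2 -> (a.+1 == b) || (b.+1 == a).
Proof. lia. Qed.

Lemma indep_num_path n : indep_num (path_graph n) = uphalf n.
Proof.
apply/eqP; rewrite eqn_leq; apply/andP; split.
  apply: indep_num_le => S /independentP indS.
  have half_lt (i : 'I_n) : (i./2 < uphalf n)%N by have := ltn_ord i; lia.
  pose h i := Ordinal (half_lt i).
  rewrite -[leqRHS]card_ord -(@card_in_imset _ _ h S) ?max_card //.
  move=> x y xS yS [hE]; apply: val_inj; apply/eqP; apply: contraT => xy.
  by have := indS x y xS yS; rewrite ord_graphE xy (half_eq_adj xy hE).
have lt_n (k : 'I_(uphalf n)) : (k.*2 < n)%N by have := ltn_ord k; lia.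
pose g k : path_graph n := Ordinal (lt_n k).
have inj_g : injective g by move=> k l [kl]; apply: val_inj => /=; lia.
rewrite -[leqLHS]card_ord -cardsT -(card_imset _ inj_g); apply: indep_num_ge.
apply/independentP => _ _ /imsetP[k _ ->] /imsetP[l _ ->].
by rewrite ord_graphE /=; lia.
Qed.

(** Rotation by one step sends an independent set to a disjoint set of the same size. *)
Lemma indep_num_cycle_le n : (2 < n)%N -> (indep_num (cycle_graph n) <= n %/ 2)%N.
Proof.
move=> n_gt2; apply: indep_num_le => S /independentP indS.
have n_gt0 : (0 < n)%N by apply: ltnW (ltnW _).
pose f (i : 'I_n) : 'I_n := Ordinal (ltn_pmod i.+1 n_gt0).
have fE (i : 'I_n) : nat_of_ord (f i) = if i.+1 == n then 0%N else i.+1.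
  rewrite /=; case: eqP => [->|/eqP ne]; first by rewrite modnn.
  by rewrite modn_small // ltn_neqAle ne ltn_ord.
have inj_f : injective f.
  move=> i j E; have := fE i; rewrite E fE => E'; apply: val_inj => /=.
  by move: E'; case: eqP; case: eqP; lia.
have dis : S :&: f @: S = set0.
  apply/setP => y; rewrite !inE; apply/negP => /andP[fS /imsetP[i iS yE]].
  rewrite {}yE in fS.
  have := indS _ _ iS fS; rewrite ord_graphE /= eqxx andbT => /negbFE/eqP E.
  have := fE i; rewrite /= -E; case: eqP => [iE i0|_ /n_Sn//].
  by move: n_gt2; rewrite -iE i0.
have : (#|S :|: f @: S| <= n)%N by rewrite -[leqRHS]card_ord max_card.
rewrite cardsU dis cards0 subn0 card_imset // addnn.
by rewrite leq_divRL // muln2.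
Qed.

Lemma indep_num_cycle n : (2 < n)%N -> indep_num (cycle_graph n) = (n %/ 2)%N.
Proof.
move=> n_gt2; apply/eqP; rewrite eqn_leq indep_num_cycle_le //=.
have lt_n (k : 'I_(n %/ 2)) : (k.*2 < n)%N by have := ltn_ord k; lia.
pose g k : cycle_graph n := Ordinal (lt_n k).
have inj_g : injective g by move=> k l [kl]; apply: val_inj => /=; lia.
rewrite -[leqLHS]card_ord -cardsT -(card_imset _ inj_g); apply: indep_num_ge.
apply/independentP => _ _ /imsetP[k _ ->] /imsetP[l _ ->].
rewrite ord_graphE /= !modn_small; have := ltn_ord k; have := ltn_ord l; lia.
Qed.

Lemma card_T_graph11 m : #|T_graph 1 1 m| = m.+3.
Proof. by rewrite card_option !card_sum !card_ord. Qed.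

Lemma indep_num_T_graph11 m : indep_num (T_graph 1 1 m) = (uphalf m).+2.
Proof.
apply/eqP; rewrite eqn_leq; apply/andP; split.
  apply: indep_num_le => S /independentP indS.
  (* The fibres of [h] are edges or single vertices: pairs along the leg, one leaf alone, the other
     leaf together with the centre. *)
  pose h (v : T_graph 1 1 m) : 'I_((uphalf m).+2) := match v with
    | Some (inr k) => inord k./2 | Some (inl (inl _)) => inord (uphalf m)
    | _ => ord_max end.
  have half_lt (k : 'I_m) : (k./2 < uphalf m)%N by have := ltn_ord k; lia.
  have hE k : val (h (Some (inr k))) = k./2 by rewrite /= inordK //; have := half_lt k; lia.
  have hl i : val (h (Some (inl (inl i)))) = uphalf m by rewrite /= inordK.
  rewrite -[leqRHS]card_ord -(@card_in_imset _ _ h S) ?max_card //.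
  move=> x y xS yS /(congr1 val); have := indS x y xS yS; rewrite graph_of_relE.
  case: x y {xS yS} => [[[i|i]|k]|] [[[j|j]|l]|]; rewrite ?hE ?hl /=.
  - by rewrite !ord1.
  - by move=> _ /n_Sn.
  - by move=> _ E; have := half_lt l; rewrite -E ltnn.
  - by move=> _ /n_Sn.
  - by move=> _ /esym/n_Sn.
  - by rewrite !ord1.
  - by move=> _ E; have := half_lt l; rewrite -E ltnNge leqnSn.
  - by rewrite ord1.
  - by move=> _ E; have := half_lt k; rewrite E ltnn.
  - by move=> _ E; have := half_lt k; rewrite E ltnNge leqnSn.
  - have [->//|kl] := eqVneq k l.
    by move=> + E; rewrite half_eq_adj // andbT => /negbFE/eqP.
  - by move=> _ E; have := half_lt k; rewrite E ltnNge leqnSn.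
  - by move=> _ /esym/n_Sn.
  - by rewrite ord1.
  - by move=> _ E; have := half_lt l; rewrite -E ltnNge leqnSn.
  - by [].
have lt_m (k : 'I_(uphalf m)) : (k.*2 < m)%N by have := ltn_ord k; lia.
(* The two leaves and every second vertex of the leg, starting next to the centre. *)
pose g (k : option (option 'I_(uphalf m))) : T_graph 1 1 m := match k with
  | Some (Some k) => Some (inr (Ordinal (lt_m k)))
  | Some None => Some (inl (inl ord0)) | None => Some (inl (inr ord0)) end.
have inj_g : injective g.
  by move=> [[k|]|] [[l|]|] //= [kl]; do 2 congr Some; apply: val_inj => /=; lia.
have -> : (uphalf m).+2 = #|[set: option (option 'I_(uphalf m))]|.
  by rewrite cardsT !card_option card_ord.
rewrite -(card_imset _ inj_g); apply: indep_num_ge.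
apply/independentP => _ _ /imsetP[k _ ->] /imsetP[l _ ->].
case: k l => [[k|]|] [[l|]|]; rewrite graph_of_relE //=.
by rewrite [_ || _](_ : _ = false) ?andbF //; lia.
Qed.

Lemma giso_deg (G H : sgraph) (k : nat) : giso G H ->
  (forall v : H, deg v = k) -> forall v : G, deg v = k.
Proof.
case=> f bij_f adj_f degH v; rewrite -(degH (f v)) /deg.
rewrite -(card_image (bij_inj bij_f)); apply: eq_card => w.
have [g gK fK] := bij_f; apply/imageP/idP => [[u uv ->]|].
  by move: uv; rewrite !inE adj_f.
by rewrite inE => fw; exists (g w); rewrite ?fK // inE -adj_f fK.
Qed.

Lemma deg_cycle n (v : cycle_graph n) : (2 < n)%N -> deg v = 2%N.
Proof.
move=> n_gt2; have n_gt0 : (0 < n)%N by apply: ltnW (ltnW _).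
have ordSE (i : 'I_n) : nat_of_ord (ordS i) = if i.+1 == n then 0%N else i.+1.
  rewrite /=; case: eqP => [->|/eqP ne]; first by rewrite modnn.
  by rewrite modn_small // ltn_neqAle ne ltn_ord.
have ordS_neq (i : 'I_n) : (i == ordS i) = false.
  apply/eqP => /(congr1 (@nat_of_ord n)); rewrite ordSE.
  by case: eqP => [iE i0|_ /n_Sn //]; move: n_gt2; rewrite -iE i0.
have ordSS_neq (i : 'I_n) : ordS (ordS i) != i.
  apply/eqP => /(congr1 (@nat_of_ord n)); rewrite ordSE ordSE.
  case: (eqVneq i.+1 n) => [iE|_]; case: eqP => // E.
  - by move=> /esym i0; move: n_gt2; rewrite -E.
  - by move=> i0; move: n_gt2; rewrite -iE -i0.
  - by move=> i0; move: n_gt2; rewrite -E -i0.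
  - by move=> /esym/eqP; rewrite ltn_eqF // ltnW.
have adjE w : @adj (cycle_graph n) v w = (w \in [:: ordS v; ord_pred v]).
  rewrite /= /rel_adj /= !inE [w == _]eq_sym [w == ord_pred _]eq_sym.
  have -> : (v.+1 %% n == w)%N = (ordS v == w) by [].
  have -> : (w.+1 %% n == v)%N = (ord_pred v == w).
    by rewrite -[LHS]/(ordS w == v) (can2_eq (@ordSK n) (@ord_predK n)) eq_sym.
  have [<-|//] := eqVneq v w.
  rewrite /= eq_sym ordS_neq /= eq_sym -(inj_eq (can_inj (@ordSK n))) ord_predK.
  by rewrite eq_sym ordS_neq.
have u2 : uniq [:: ordS v; ord_pred v].
  rewrite /= inE andbT -(inj_eq (can_inj (@ordSK n))) ord_predK; exact: ordSS_neq.
rewrite /deg (eq_card (B := mem [:: ordS v; ord_pred v])); last first.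
  by move=> w; rewrite inE adjE.
exact: (card_uniqP u2).
Qed.

(** * Degree bounds on the index, and index at most 2 *)

Section IndexTwo.
Variables (R : realType) (G : sgraph) (alpha : R).
Hypotheses (alpha_ge0 : 0 <= alpha) (alpha_lt1 : alpha < 1).
Hypothesis G_gt0 : (0 < #|G|)%N.
Local Notation lam := (Aalpha_index G alpha).

Lemma min_deg_index_ge k : (forall v : G, k <= deg v)%N -> k%:R <= lam.
Proof.
move=> dk; apply: (subsolution_le G_gt0 (f := fun=> 1)) => //.
  by case/card_gt0P: G_gt0 => v _; exists v; rewrite oner_eq0.
by move=> v; rewrite Aop_const1 mulr1 ler_nat.
Qed.

Lemma max_deg_index_le k : gconnected G -> (forall v : G, deg v <= k)%N ->
  lam <= k%:R.
Proof.
(* Supersolutions give strict bounds, so the bound is first proved for [k%:R + e]. *)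
move=> conG dk; apply/ler_addgt0Pr => e e_gt0; apply: ltW.
have lt_k (v : G) : Aop alpha (fun=> 1) v < (k%:R + e) * 1.
  rewrite Aop_const1 mulr1; apply: le_lt_trans (_ : k%:R < _).
    by rewrite ler_nat.
  by rewrite ltrDl.
apply: (supersolution_lt alpha_ge0 alpha_lt1 G_gt0 conG (f := fun=> 1)) => //.
  by move=> v; apply: ltW.
by case/card_gt0P: G_gt0 => v _; exists v.
Qed.

(* The indicator of Z is a subsolution for 2; equality makes it an eigenvector,
   hence positive everywhere. *)
Lemma core_regular (Z : {set G}) : gconnected G -> lam <= 2 -> Z != set0 ->
  (forall v, v \in Z -> 1 < #|[set w in Z | adj v w]|)%N ->
  forall v : G, deg v = 2%N.
Proof.
move=> conG lam2 /set0Pn[v0 v0Z] coreZ; pose f (v : G) : R := (v \in Z)%:R.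
have f_ge0 v : 0 <= f v by rewrite ler0n.
have fA v : 2 * f v <= Aop alpha f v.
  have k_ge0 : 0 <= 1 - alpha by rewrite subr_ge0 ltW.
  have [vZ|vZ] := boolP (v \in Z); last first.
    have fv : f v = 0 by rewrite /f (negPf vZ).
    rewrite /Aop fv !mulr0 add0r; apply: mulr_ge0 => //.
    by apply: sumr_ge0 => w _; apply: f_ge0.
  have -> : 2 * f v = alpha * 2 * f v + (1 - alpha) * 2.
    by rewrite {1 2}/f vZ /=; ring.
  apply: lerD.
    rewrite ler_wpM2r // ler_wpM2l // ler_nat (leq_trans (coreZ v vZ)) //.
    apply/subset_leq_card/fintype.subsetP => w; rewrite !inE.
    by case/andP.
  apply: ler_wpM2l => //; apply: le_trans (_ : #|[set w in Z | adj v w]|%:R <= _).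
    by rewrite ler_nat coreZ.
  rewrite -sum1_card natr_sum big_mkcond [leRHS]big_mkcond; apply: ler_sum => w _.
  by rewrite inE /f andbC; case: (adj v w) => //=; case: (w \in Z).
have [|f_gt0 fE] := subsolution_eq alpha_lt1 G_gt0 conG f_ge0 _ fA lam2.
  by exists v0; rewrite /f v0Z oner_eq0.
have f1 v : f v = 1 by have := f_gt0 v; rewrite /f; case: (v \in Z); rewrite ?ltxx.
move=> v; have := fE v; rewrite f1 mulr1.
have -> : Aop alpha f v = (deg v)%:R.
  by rewrite -(Aop_const1 alpha v) /Aop f1; under eq_bigr do rewrite f1.
by move/eqP; rewrite eqr_nat => /eqP.
Qed.

End IndexTwo.

(** * The position of the pendant vertex *)

Lemma broom_card (G : sgraph) (x0 : G) s j q : broom x0 s j q -> #|G| = (size s).+1.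
Proof.
case=> [[us qs] s_all _ _ _]; have uqs : uniq (q :: s) by rewrite /= qs.
by rewrite -[RHS]/(size (q :: s)) -(card_uniqP uqs); apply: eq_card => v; rewrite s_all.
Qed.

Lemma broom_rev (G : sgraph) (x0 : G) s j q :
  broom x0 s j q -> broom x0 (rev s) (size s - j.+1) q.
Proof.
case=> [[us qs] s_all [j_gt0 j_lt] adj_s adj_q].
split=> [||||i]; rewrite ?rev_uniq ?mem_rev ?size_rev //.
- by move=> v; rewrite inE mem_rev -in_cons.
- by nat_lia.
- move=> i k ik ks; rewrite !nth_rev //; last exact: ltn_trans ks.
  by rewrite adj_sym adj_s; nat_lia.
- by move=> si; rewrite nth_rev // adj_q; nat_lia.
Qed.

Lemma broom_adjE (G : sgraph) (x0 : G) s j q i k : broom x0 s j q ->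
  (i < size s)%N -> (k < size s)%N ->
  adj (nth x0 s i) (nth x0 s k) = (k == i.+1) || (i == k.+1).
Proof.
case=> _ _ _ adj_s _ si sk; case: (ltngtP i k) => [ik|ki|->].
- by rewrite adj_s //; nat_lia.
- by rewrite adj_sym adj_s //; nat_lia.
- by rewrite adj_irr; nat_lia.
Qed.

(** Position 1 of [s] is the branch vertex, position 0 and [q] are the short legs, and the rest of
    [s] is the long leg. *)
Lemma broom1_iso (G : sgraph) (x0 : G) s q :
  broom x0 s 1 q -> giso G (T_graph 1 1 (#|G| - 3)).
Proof.
move=> br; have sz := broom_card br; set m := (#|G| - 3)%N.
have [[us qs] s_all [_ s_gt2] adj_s adj_q] := br.
have szE : size s = m.+2 by rewrite /m sz; nat_lia.
have mE k : (k < m)%N -> (k.+2 < size s)%N by rewrite szE.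
pose p := nth x0 s.
pose g (v : T_graph 1 1 m) : G := match v with
  | None => p 1%N | Some (inl (inl _)) => p 0%N | Some (inl (inr _)) => q
  | Some (inr k) => p k.+2 end.
have inj_p i k : (i < size s)%N -> (k < size s)%N -> p i = p k -> i = k.
  by move=> si sk /eqP; rewrite nth_uniq // => /eqP.
have pNq i : (i < size s)%N -> p i = q -> False.
  by move=> si pq; move/negP: qs; apply; rewrite -pq mem_nth.
have s0 : (0 < size s)%N by rewrite szE.
have s1 : (1 < size s)%N by rewrite szE.
apply: (@giso_of_surj G (T_graph 1 1 m) g).
- case=> [[[i|i]|k]|] [[[j|j]|l]|] //=; rewrite ?ord1 //.
  + by move/pNq => /(_ s0).
  + by move/inj_p => /(_ s0 (mE _ (ltn_ord l))).
  + by move/inj_p => /(_ s0 s1).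
  + by move/esym/pNq => /(_ s0).
  + by move/esym/pNq => /(_ (mE _ (ltn_ord l))).
  + by move/esym/pNq => /(_ s1).
  + by move/inj_p => /(_ (mE _ (ltn_ord k)) s0).
  + by move/pNq => /(_ (mE _ (ltn_ord k))).
  + by move/inj_p => /(_ (mE _ (ltn_ord k)) (mE _ (ltn_ord l))) [/val_inj->].
  + by move/inj_p => /(_ (mE _ (ltn_ord k)) s1).
  + by move/inj_p => /(_ s1 s0).
  + by move/pNq => /(_ s1).
  + by move/inj_p => /(_ s1 (mE _ (ltn_ord l))).
- move=> v; have := s_all v; rewrite inE => /predU1P[->|/(nthP x0)[i]].
    by exists (Some (inl (inr ord0))).
  case: i => [|[|i]] si <-.
  + by exists (Some (inl (inl ord0))).
  + by exists None.
  have im : (i < m)%N by rewrite szE in si.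
  by exists (Some (inr (Ordinal im))).
have adj_p i k : (i < size s)%N -> (k < size s)%N ->
  adj (p i) (p k) = (k == i.+1) || (i == k.+1) by apply: broom_adjE br.
case=> [[[i|i]|k]|] [[[j|j]|l]|]; rewrite graph_of_relE /=
  ?(adj_sym _ q) ?adj_irr ?adj_p ?adj_q ?ord1 ?mE ?eqxx ?andbF //=.
rewrite !eqSS; have [->|kl] := eqVneq k l.
  by rewrite eqxx /= (ltn_eqF (ltnSn l)).
rewrite [l == _ :> nat]eq_sym [k == _ :> nat]eq_sym.
have -> // : Some (inr k : 'I_1 + 'I_1 + 'I_m) != Some (inr l).
by apply: contraNneq kl => -[->].
Qed.

Section BroomIndex.
Variables (R : realType) (G : sgraph) (alpha t L : R).
Hypotheses (alpha_ge0 : 0 <= alpha) (alpha_lt1 : alpha < 1).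
Hypotheses (t_gt0 : 0 < t) (t_le1 : t <= 1).
Hypothesis alpha_t : alpha * t = (1 - alpha) * (1 - t ^+ 2).
Hypothesis L_t : L * t = (1 - alpha) * (3 - t ^+ 2).
Hypothesis G_gt0 : (0 < #|G|)%N.
Local Notation lam := (Aalpha_index G alpha).

(** Here [j] is the length of the shorter arm of [s]. If it is at least 3, both arms contain three
    vertices and E7 appears; if it is 2, the other arm has at least five and E8 appears. *)
Lemma broom_short (x0 : G) s j q : broom x0 s j q -> lam < L ->
  (7 < size s)%N -> (j <= size s - j.+1)%N -> j = 1%N.
Proof.
move=> br lamL s_gt7 js.
have [[us qs] s_all [j_gt0 j_lt] adj_s adj_q] := br.
have not_le : ~ L <= lam by rewrite leNgt lamL.
pose p := nth x0 s.
have inj_p i k : (i < size s)%N -> (k < size s)%N -> (p i == p k) = (i == k).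
  by move=> si sk; rewrite nth_uniq.
have pNq i : (i < size s)%N -> (p i == q) = false.
  by move=> si; apply: contraNF qs => /eqP<-; apply: mem_nth.
have qNp i : (i < size s)%N -> (q == p i) = false by rewrite eq_sym; apply: pNq.
have adj_p i k : (i < size s)%N -> (k < size s)%N ->
  adj (p i) (p k) = (k == i.+1) || (i == k.+1) by apply: broom_adjE br.
have adj_pq : adj (p j) q by rewrite adj_sym adj_q ?eqxx //; nat_lia.
have [j_le1|j_gt1] := leqP j 1; first by nat_lia.
case: not_le; have [j2|j_ne2] := eqVneq j 2.
  rewrite j2 in adj_pq.
  apply: (index_ge_E8 alpha_ge0 alpha_lt1 t_gt0 t_le1 alpha_t L_t G_gt0 (u := p 2)
    (a := q) (b1 := p 1%N) (b2 := p 0%N) (c1 := p 3) (c2 := p 4) (c3 := p 5)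
    (c4 := p 6) (c5 := p 7)); rewrite /= ?inE ?inj_p ?pNq ?qNp ?adj_p ?adj_pq //=;
    nat_lia.
apply: (index_ge_E7 alpha_ge0 alpha_lt1 t_gt0 t_le1 alpha_t L_t G_gt0 (u := p j)
  (a := q) (b1 := p j.-1) (b2 := p j.-2) (b3 := p (j - 3)%N) (c1 := p j.+1)
  (c2 := p j.+2) (c3 := p j.+3));
  rewrite /= ?inE ?inj_p ?pNq ?qNp ?adj_p ?adj_pq //=; nat_lia.
Qed.

End BroomIndex.

(** * The index of [T_graph 1 1 m] lies below [L] *)

Section PendantFork.
Variables (R : realType) (alpha t L : R).
Hypotheses (alpha_ge0 : 0 <= alpha) (alpha_lt1 : alpha < 1).
Hypothesis t_gt0 : 0 < t.
Hypothesis alpha_t : alpha * t = (1 - alpha) * (1 - t ^+ 2).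
Hypothesis L_t : L * t = (1 - alpha) * (3 - t ^+ 2).

Lemma decay_eq (n : nat) (y s : R) :
  (3 - t ^+ 2) * y = (1 - t ^+ 2) * n%:R * y + t * s ->
  alpha * n%:R * y + (1 - alpha) * s = L * y.
Proof.
move=> E; apply: (mulfI (lt0r_neq0 t_gt0)).
have -> : t * (L * y) = (1 - alpha) * ((3 - t ^+ 2) * y).
  by rewrite mulrA [t * L]mulrC L_t mulrA.
rewrite E; have -> : t * (alpha * n%:R * y + (1 - alpha) * s) =
  alpha * t * n%:R * y + (1 - alpha) * (t * s) by ring.
by rewrite alpha_t; ring.
Qed.

Lemma decay_lt (n : nat) (y s : R) :
  (1 - t ^+ 2) * n%:R * y + t * s < (3 - t ^+ 2) * y ->
  alpha * n%:R * y + (1 - alpha) * s < L * y.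
Proof.
by rewrite !ltNge; apply: contraNN; rewrite (decay_ineqE alpha_lt1 t_gt0 alpha_t L_t).
Qed.

(** The limit eigenvector, cut off at the end of the leg, satisfies the equation for [L] except at
    the last vertex, where the missing neighbour makes the inequality strict. *)
Lemma T_graph11_index_lt m : (0 < m)%N -> Aalpha_index (T_graph 1 1 m) alpha < L.
Proof.
case: m => // m _; set T := T_graph 1 1 m.+1.
(* [node i] lies at distance [i] from the branch vertex along the long leg, and [node 0] is the
   branch vertex; [leg] recovers [i]. *)
pose node i : T := if i is i'.+1 then Some (inr (inord i')) else None.
pose leg (v : T) : nat := if v is Some (inr k) then k.+1 else 0%N.
pose y (v : T) : R := if v is Some (inl _) then t else 2 * t ^+ leg v.
have node_leg (k : 'I_m.+1) : Some (inr k) = node k.+1 by rewrite /= inord_val.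
have leg_node i : (i <= m.+1)%N -> leg (node i) = i.
  by case: i => // i im; rewrite /= inordK.
have y_node i : (i <= m.+1)%N -> y (node i) = 2 * t ^+ i.
  by move=> im; rewrite -[in RHS](leg_node i im); case: i im.
have y_gt0 v : 0 < y v.
  by case: v => [[_|k]|] //; rewrite /y mulr_gt0 ?exprn_gt0.
have y_ge0 v : 0 <= y v by apply: ltW.
have Aop_le v s : uniq s -> (forall w, adj v w -> w \in s) ->
    Aop alpha y v <= alpha * (size s)%:R * y v + (1 - alpha) * \sum_(w <- s) y w.
  exact: Aop_nb_le.
have T_gt0 : (0 < #|T|)%N by rewrite card_T_graph11.
have leg_le (k : 'I_m.+1) w : adj (Some (inr k) : T) w ->
    w = node k \/ (k < m)%N /\ w = node k.+2.
  rewrite graph_of_relE; case: w => [[[i|i]|l]|] /andP[_] //=.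
    case/orP => /eqP kl; last by left; rewrite node_leg kl.
    right; rewrite (node_leg l) -kl; split=> //.
    by have := ltn_ord l; rewrite -kl.
  by move=> /eqP ->; left.
have last_lt : Aop alpha y (node m.+1) < L * y (node m.+1).
  apply: le_lt_trans (Aop_le _ [:: node m] isT _) _.
    move=> w; rewrite -[node m.+1]/(Some (inr (inord m))) => /leg_le.
    by rewrite inordK // ltnn inE => -[->|[]//]; rewrite eqxx.
  apply: decay_lt; rewrite big_cons big_nil !y_node // [t ^+ m.+1]exprS addr0 /=.
  have : 0 < t ^+ m * t by rewrite mulr_gt0 ?exprn_gt0.
  lra.
apply: (supersolution_lt alpha_ge0 alpha_lt1 T_gt0 (@T_graph11_connected _) y_gt0);
  last by exists (node m.+1).
case=> [[i|k]|].
- apply: le_trans (Aop_le _ [:: None] isT _) _.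
    by move=> w; rewrite graph_of_relE; case: i w => [i|i] [[[j|j]|l]|] //=;
      rewrite !ord1 ?eqxx.
  rewrite (decay_eq (n := 1)) // big_cons big_nil /y /=; ring.
- have [->|km] := eqVneq k ord_max.
    by rewrite node_leg; apply: ltW.
  have {}km : (k < m)%N by rewrite ltn_neqAle -ltnS ltn_ord andbT.
  apply: le_trans (Aop_le _ [:: node k; node k.+2] _ _) _.
  + have kk2 : node k != node k.+2.
      apply/eqP => /(congr1 leg); rewrite (leg_node k) ?(leg_node k.+2) //.
        by move=> E; nat_lia.
      by nat_lia.
    by rewrite cons_uniq mem_seq1 kk2.
  + by move=> w /leg_le[->|[_ ->]]; rewrite !inE eqxx ?orbT.
  rewrite node_leg (decay_eq (n := 2)) // !big_cons big_nil !y_node; [|nat_lia..].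
  rewrite !exprS; ring.
apply: le_trans (Aop_le _ [:: Some (inl (inl ord0)); Some (inl (inr ord0)); node 1%N]
  isT _) _.
  move=> w; rewrite graph_of_relE; case: w => [[[j|j]|l]|] //=; rewrite ?ord1 //.
  rewrite orbF => /eqP l0; rewrite !inE; apply/orP; right; apply/orP; right.
  by rewrite node_leg l0.
rewrite (decay_eq (n := 3)) // !big_cons big_nil y_node // /y /=; ring.
Qed.

End PendantFork.

(** The bound [2 <= L] holds because [L * t - 2 * t = (1 - alpha) * (1 - t) ^+ 2]; it places the
    path threshold below the tree threshold. *)
Lemma threshold_exists (R : realType) (alpha : R) : 0 <= alpha -> alpha < 1 ->
  exists t L, [/\ 0 < t, t <= 1, alpha * t = (1 - alpha) * (1 - t ^+ 2),
    L * t = (1 - alpha) * (3 - t ^+ 2) & 2 <= L].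
Proof.
move=> alpha_ge0 alpha_lt1; have [t [t_gt0 t_le1 tE]] := decay_rate alpha_ge0 alpha_lt1.
exists t, ((1 - alpha) * (3 - t ^+ 2) / t).
have LtE : (1 - alpha) * (3 - t ^+ 2) / t * t = (1 - alpha) * (3 - t ^+ 2).
  by rewrite divfK // gt_eqF.
split=> //; rewrite -(ler_pM2r t_gt0) LtE -subr_ge0.
have -> : (1 - alpha) * (3 - t ^+ 2) - 2 * t = (1 - alpha) * (1 - t) ^+ 2.
  transitivity ((1 - alpha) * (3 - t ^+ 2) -
    2 * ((1 - alpha) * t + (1 - alpha) * (1 - t ^+ 2))); last by ring.
  by rewrite -tE; ring.
by rewrite mulr_ge0 ?sqr_ge0 // subr_ge0 ltW.
Qed.

(** * The complete graph and the star *)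

Lemma complete_iso (G : sgraph) : indep_num G = 1%N -> giso G (complete_graph #|G|).
Proof.
move=> iG; apply: (@giso_of_surj G (complete_graph #|G|) (fun i : 'I_#|G| => enum_val i)).
- exact: enum_val_inj.
- by move=> v; exists (enum_rank v); rewrite enum_rankK.
move=> x y; rewrite graph_of_relE andbT; have [->|xy] := eqVneq x y.
  exact: adj_irr.
apply: contraT => nadj; suff : (1 < indep_num G)%N by rewrite iG.
have xy' : enum_val x != enum_val y :> G by rewrite (inj_eq enum_val_inj).
rewrite -(_ : #|[set (enum_val x : G); enum_val y]| = 2%N); last by rewrite cards2 xy'.
apply: indep_num_ge; apply/independentP => a b; rewrite !inE.
by move=> /orP[]/eqP-> /orP[]/eqP->; rewrite ?adj_irr ?(negbTE nadj) // adj_sym (negbTE nadj).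
Qed.

(** A maximum independent set [S] misses a single vertex [u]. The first edge of a path from a vertex
    of [S] to [u] leaves [S], hence ends at [u]. *)
Lemma star_iso (G : sgraph) : gconnected G -> (1 < #|G|)%N ->
  indep_num G = (#|G| - 1)%N -> giso G (complete_bipartite 1 (#|G| - 1)).
Proof.
move=> conG G_gt1 iG; have [S /independentP indS cardS] := indep_num_ex G.
rewrite iG in cardS; have /card_gt0P[u uS] : (0 < #|~: S|)%N.
  by rewrite -subn_gt0 cardsCs setCK cardS; nat_lia.
have outS v : v \notin S -> v = u.
  move=> vS; apply/eqP; apply: contraT => vu.
  suff : (#|[set u; v]| <= #|~: S|)%N.
    by rewrite cards2 eq_sym vu cardsCs setCK cardS; nat_lia.
  apply/subset_leq_card/fintype.subsetP => w; rewrite !inE.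
  by case/orP => /eqP -> //; move: uS; rewrite inE.
have nuS : u \notin S by rewrite inE in uS.
have adj_u v : v \in S -> adj u v.
  move=> vS; have /connectP[[|w p] /=] := conG v u.
    by move=> _ vu; rewrite vu vS in nuS.
  case/andP=> vw _ _; have [wS|/outS wu] := boolP (w \in S).
    by rewrite indS in vw.
  by rewrite adj_sym -wu.
have sz : size (enum S) = (#|G| - 1)%N by rewrite -cardE cardS.
pose p k := nth u (enum S) k.
have pS (k : 'I_(#|G| - 1)) : p k \in S by rewrite -mem_enum mem_nth // sz.
pose g (x : complete_bipartite 1 (#|G| - 1)) : G := match x with
  | inl _ => u | inr k => p k end.
apply: (@giso_of_surj G (complete_bipartite 1 (#|G| - 1)) g).
- case=> [i|k] [j|l] //=; rewrite ?ord1 //.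
  + by move=> E; move: (pS l); rewrite -E (negPf nuS).
  + by move=> E; move: (pS k); rewrite E (negPf nuS).
  move/eqP; rewrite nth_uniq ?enum_uniq ?sz // => /eqP E.
  by congr inr; apply: val_inj.
- move=> v; have [vS|/outS ->] := boolP (v \in S); last by exists (inl ord0).
  have iv : (index v (enum S) < #|G| - 1)%N by rewrite -sz index_mem mem_enum.
  by exists (inr (Ordinal iv)); rewrite /= /p nth_index // mem_enum.
case=> [i|k] [j|l]; rewrite graph_of_relE /= ?andbF ?andbT.
- exact: adj_irr.
- by rewrite adj_u.
- by rewrite adj_sym adj_u.
- by rewrite indS.
Qed.

(** * Graphs with index at most that of the path, the cycle or the tree *)

Section Minimizers.
Variables (R : realType) (alpha : R) (G : sgraph).
Hypotheses (alpha_ge0 : 0 <= alpha) (alpha_lt1 : alpha < 1).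
Hypotheses (conG : gconnected G) (G_gt0 : (0 < #|G|)%N).
Local Notation lam := (Aalpha_index G alpha).

(** With a vertex of degree at least 3, [G] is a path with a pendant vertex and its index is too
    large; otherwise it is a path or a cycle, and a cycle has index at least 2. *)
Lemma index_le_path_iso :
  lam <= Aalpha_index (path_graph #|G|) alpha -> giso G (path_graph #|G|).
Proof.
move=> le_path; pose y0 : path_graph #|G| := Ordinal G_gt0.
have path2 := path_like_index_lt2 alpha_ge0 alpha_lt1 (@path_graph_connected _)
  (path_graph_like y0).
have [t [L [t_gt0 t_le1 tE LE L2]]] := threshold_exists alpha_ge0 alpha_lt1.
have [/existsP ex3|no3] := boolP [exists v : G, 2 < deg v]%N.
  have lamL : lam < L by apply: le_lt_trans le_path (lt_le_trans path2 L2).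
  have [x0 [s [j [q br]]]] :=
    broom_exists alpha_ge0 alpha_lt1 t_gt0 t_le1 tE LE G_gt0 conG lamL ex3.
  have sz : size (enum 'I_#|G|) = (size s).+1 by rewrite size_enum_ord (broom_card br).
  have := broom_index_gt alpha_ge0 alpha_lt1 (@path_graph_connected _)
    (path_graph_like y0) br sz.
  by rewrite ltNge le_path.
have d2 (v : G) : (deg v <= 2)%N.
  by rewrite leqNgt; apply: contraNN no3 => dv; apply/existsP; exists v.
have [//|[n_gt2 isoC]] := max_deg2_iso conG G_gt0 d2.
suff : 2 <= lam by rewrite leNgt (le_lt_trans le_path path2).
apply: (@min_deg_index_ge R G alpha G_gt0 2) => v.
by rewrite (giso_deg isoC (fun v => deg_cycle v n_gt2)).
Qed.

(** Greedy selection would give [2 i >= n], so some nonempty [Z] has inner degrees at least 2; index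
    at most 2 then makes [G] 2-regular. *)
Lemma index_le_cycle_iso : (2 < #|G|)%N -> (2 * indep_num G < #|G|)%N ->
  lam <= Aalpha_index (cycle_graph #|G|) alpha -> giso G (cycle_graph #|G|).
Proof.
move=> n_gt2 iG le_cycle.
have lam2 : lam <= 2.
  apply: le_trans le_cycle _; apply: max_deg_index_le => //.
  - by rewrite card_ord.
  - exact: cycle_graph_connected.
  - by move=> v; rewrite deg_cycle.
have [Z Z0 coreZ] : exists2 Z : {set G}, Z != set0 &
    forall v, v \in Z -> (1 < #|[set w in Z | adj v w]|)%N.
  have [/existsP[Z /andP[Z0 /forall_inP coreZ]]|no_core] := boolP
      [exists Z : {set G}, (Z != set0) && [forall v in Z, 1 < #|[set w in Z | adj v w]|]%N].
    by exists Z.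
  exfalso; move: iG; rewrite ltnNge => /negP; apply.
  apply: degenerate_indep_num => Z Z0.
  apply/exists_inP; apply: contraNT no_core; rewrite negb_exists_in => /forall_inP core.
  by apply/existsP; exists Z; rewrite Z0; apply/forall_inP => v /core; rewrite -ltnNge.
have d2 := core_regular alpha_ge0 alpha_lt1 G_gt0 conG lam2 Z0 coreZ.
have [|isoP|[]//] := max_deg2_iso conG G_gt0; first by move=> v; rewrite d2.
by move: iG; rewrite (giso_indep_num isoP) indep_num_path; nat_lia.
Qed.

(** Paths and cycles of even order have independence number at most n/2, so a vertex of degree at
    least 3 exists. Reversing [s] if necessary makes the arm before [j] the shorter one. *)
Lemma index_le_T_graph_iso : (8 < #|G|)%N -> ~~ odd #|G| ->
  indep_num G = (#|G| %/ 2).+1 ->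
  lam <= Aalpha_index (T_graph 1 1 (#|G| - 3)) alpha ->
  giso G (T_graph 1 1 (#|G| - 3)).
Proof.
move=> n_gt8 n_even iG le_T.
have [t [L [t_gt0 t_le1 tE LE _]]] := threshold_exists alpha_ge0 alpha_lt1.
have lamL : lam < L.
  apply: le_lt_trans le_T _.
  by apply: (T_graph11_index_lt alpha_ge0 alpha_lt1 t_gt0 tE LE); nat_lia.
have [/existsP ex3|no3] := boolP [exists v : G, 2 < deg v]%N.
  have [x0 [s [j [q br]]]] :=
    broom_exists alpha_ge0 alpha_lt1 t_gt0 t_le1 tE LE G_gt0 conG lamL ex3.
  have s_gt7 : (7 < size s)%N by have := broom_card br; nat_lia.
  have [_ _ [j_gt0 j_lt] _ _] := br.
  have short := broom_short alpha_ge0 alpha_lt1 t_gt0 t_le1 tE LE G_gt0 _ lamL.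
  have [js|/ltnW js] := leqP j (size s - j.+1).
    by apply: (broom1_iso (x0 := x0) (s := s) (q := q)); rewrite -(short _ _ _ _ br).
  have br' := broom_rev br.
  apply: (broom1_iso (x0 := x0) (s := rev s) (q := q)).
  by rewrite -(short _ _ _ _ br') ?size_rev //; nat_lia.
have d2 (v : G) : (deg v <= 2)%N.
  by rewrite leqNgt; apply: contraNN no3 => dv; apply/existsP; exists v.
have [isoP|[n_gt2 isoC]] := max_deg2_iso conG G_gt0 d2.
  by move: iG; rewrite (giso_indep_num isoP) indep_num_path; nat_lia.
have := indep_num_cycle_le n_gt2.
by rewrite -(giso_indep_num isoC) iG ltnn.
Qed.

End Minimizers.

Theorem theorem1p1 (R : realType) (n i : nat) (alpha : R) (G : sgraph)
    (n_ge1 : (1 <= n)%N) (alpha_ge0 : 0 <= alpha) (alpha_lt1 : alpha < 1)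
    (G_in : in_Gni n i G)
    (G_min : forall H : sgraph, in_Gni n i H ->
       Aalpha_index G alpha <= Aalpha_index H alpha) :
  [/\ (i = 1)%N -> giso G (complete_graph n),
      i = (n %/ 2)%N ->
        (~~ odd n -> giso G (path_graph n)) /\
        (odd n -> giso G (cycle_graph n)),
      i = uphalf n -> giso G (path_graph n),
      i = (n %/ 2).+1 -> (9 <= n)%N ->
        (odd n -> giso G (path_graph n)) /\
        (~~ odd n -> giso G (T_graph 1 1 (n - 3)))
    & i = (n - 1)%N -> giso G (complete_bipartite 1 (n - 1))].
Proof.
case: G_in => cardG conG iG.
have G_gt0 : (0 < #|G|)%N by rewrite cardG.
have i_gt0 : (0 < i)%N.
  case/card_gt0P: G_gt0 => v _; rewrite -iG -(cards1 v).
  exact/indep_num_ge/independent1.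
(* This also serves even [n] in the second claim and odd [n] in the fourth, where [i] equals
   [uphalf n]. *)
have path_case : i = uphalf n -> giso G (path_graph n).
  move=> iE; rewrite -cardG; apply: (index_le_path_iso alpha_ge0 alpha_lt1) => //.
  rewrite cardG; apply: G_min; split; first exact: card_ord.
    exact: path_graph_connected.
  by rewrite indep_num_path.
split=> //.
- by move=> i1; rewrite -cardG; apply: complete_iso; rewrite iG.
- move=> iE; split=> n_odd; first by apply: path_case; nat_lia.
  (* The odd order [n = 1] would give [i = 0]. *)
  have n_gt2 : (2 < n)%N by nat_lia.
  rewrite -cardG; apply: (index_le_cycle_iso alpha_ge0 alpha_lt1) => //; rewrite cardG //.
    by rewrite iG; nat_lia.
  apply: G_min; split; first exact: card_ord.
    exact: cycle_graph_connected.
  by rewrite indep_num_cycle.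
- move=> iE n_ge9; split=> n_odd; first by apply: path_case; nat_lia.
  rewrite -cardG; apply: (index_le_T_graph_iso alpha_ge0 alpha_lt1) => //;
    rewrite cardG ?iG //.
  apply: G_min; split; first by rewrite card_T_graph11; nat_lia.
    exact: T_graph11_connected.
  by rewrite indep_num_T_graph11; nat_lia.
- move=> iE; rewrite -cardG; apply: star_iso => //; last by rewrite iG cardG.
  by rewrite cardG; nat_lia.
Qed.
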